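(* Let $-1/2<t\le 0$, let $\mu$ be the Lebesgue measure restricted to $[t,t+1]$, and let $\rho=\frac12(\mu\times\delta_0+\delta_0\times\mu)$, a measure on $\mathbb{R}^2$. (1) If $t=0$, then $\rho$ is spectral and has a unique spectrum up to translations (that is, $\rho$ has a spectrum, and any two spectra of $\rho$ are translates of each other by a vector of $\mathbb{R}^2$). (2) If $2t+1=\frac1a$ (i.e. $t=-\frac12+\frac1{2a}$) for some integer $a>1$, then $\rho$ is not spectral.
   Context: $\delta_0$ is the Dirac measure at $0$. Thus $\int F\,d\rho=\frac12\int_t^{t+1}F(x,0)\,dx+\frac12\int_t^{t+1}F(0,y)\,dy$. For $(a,b)\in\mathbb{R}^2$ let $e_{a,b}(x,y)=e^{2\pi i(ax+by)}$, and for a countable set $\Lambda\subset\mathbb{R}^2$ let $E(\Lambda)=\{e_{a,b}:(a,b)\in\Lambda\}$. A probability measure $\rho$ on $\mathbb{R}^2$ is spectral if there is a countable set $\Lambda\subset\mathbb{R}^2$ such that $E(\Lambda)$ is an orthonormal basis for $L^2(\rho)$; such a $\Lambda$ is called a spectrum of $\rho$. *)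

(* Defs.v *)
From HB Require Import structures.
From mathcomp Require Import all_boot all_order all_algebra.
From mathcomp Require Import all_classical all_reals all_analysis.
From mathcomp Require Import complex.

Set Implicit Arguments.
Unset Strict Implicit.
Unset Printing Implicit Defensive.
Import Order.TTheory GRing.Theory Num.Theory.
Import numFieldNormedType.Exports.

Local Open Scope classical_set_scope.
Local Open Scope ring_scope.

Section complex_L2.
Context d (T : measurableType d) (R : realType).
Variable mu : {measure set T -> \bar R}.
Implicit Types (f g : T -> R[i]) (B : set (T -> R[i])).

Definition L2norm f : \bar R := Lnorm mu 2%:E (fun x => (Normc.normc (f x))%:E).

(* Complex square-integrable functions; elements of the Hilbert space L^2(mu)
   are their classes modulo a.e. equality, on which [L2norm] and [L2dot] are
   well defined. *)
Definition L2 : set (T -> R[i]) :=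
  [set f | measurable_fun setT (fun x => complex.Re (f x)) /\
           measurable_fun setT (fun x => complex.Im (f x)) /\
           (L2norm f < +oo)%E].

Definition cintegral f : R[i] :=
  Complex (Rintegral mu setT (fun x => complex.Re (f x)))
          (Rintegral mu setT (fun x => complex.Im (f x))).

Definition L2dot f g : R[i] := cintegral (fun x => f x * conjc (g x)).

(* Distinct functions of [B] are required to be orthogonal, so [B] is an
   orthonormal family: no class in L^2(mu) may be listed twice. *)
Definition orthonormal B := forall f g, B f -> B g ->
  L2dot f g = (`[< f = g >])%:R.

Definition dense_span B := forall f, L2 f -> forall e : R, 0 < e ->
  exists (n : nat) (c : 'I_n -> R[i]) (u : 'I_n -> T -> R[i]),
    (forall i, B (u i)) /\
    (L2norm (fun x => f x - \sum_(i < n) c i * u i x)%R < e%:E)%E.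

Definition orthonormal_basis B :=
  [/\ B `<=` L2, orthonormal B & dense_span B].

End complex_L2.

Section spectral.
Context {R : realType}.

Definition plane := (measurableTypeR R * measurableTypeR R)%type.

(* e^{2 pi i (a x + b y)} *)
Definition expo (l : R * R) (p : plane) : R[i] :=
  let theta := 2 * pi * (l.1 * p.1 + l.2 * p.2) in
  Complex (cos theta) (sin theta).

Definition exps (L : set (R * R)) : set (plane -> R[i]) := expo @` L.

Definition spectrum (rho : probability plane R) (L : set (R * R)) :=
  countable L /\ orthonormal_basis rho (exps L).

Definition spectral (rho : probability plane R) := exists L, spectrum rho L.

End spectral.
Arguments plane : clear implicits.

Section rho.
Context {R : realType} (t : R).

Definition lebI : set (measurableTypeR R) -> \bar R :=
  mrestr (@lebesgue_measure R) (measurable_itv `[t, t + 1]).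

HB.instance Definition _ := Measure.on lebI.

Lemma lebI_setT : lebI setT = 1%E.
Proof.
by rewrite /lebI /mrestr setTI lebesgue_measure_itv/= lte_fin ltrDl ltr01
  -EFinB addrAC subrr add0r.
Qed.

HB.instance Definition _ := Measure_isProbability.Build _ _ R lebI lebI_setT.

Local Notation dirac0 := (@dirac _ (measurableTypeR R) 0%R R).

Definition rho : set (plane R) -> \bar R :=
  mscale (2^-1)%:nng
    (measure_add (lebI \x dirac0)%E (dirac0 \x lebI)%E).

HB.instance Definition _ := Measure.on rho.

Lemma rhoE A :
  rho A = ((2^-1)%:E * ((lebI \x dirac0) A + (dirac0 \x lebI) A))%E.
Proof. by congr (_ * _)%E; exact: measure_addE. Qed.

Lemma rho_setT : rho setT = 1%E.
Proof.
by rewrite rhoE !probability_setT -EFinD -EFinM mulVf.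
Qed.

HB.instance Definition _ := Measure_isProbability.Build _ _ R rho rho_setT.

End rho.

(* Main.v *)
Require Import Defs.
From HB Require Import structures.
From mathcomp Require Import all_boot all_order all_algebra.
From mathcomp Require Import all_classical all_reals all_analysis.
From mathcomp Require Import complex.
From mathcomp Require Import measurable_realfun.
From mathcomp Require Import ring lra.

Set Implicit Arguments.
Unset Strict Implicit.
Unset Printing Implicit Defensive.
Import Order.TTheory GRing.Theory Num.Theory.
Import numFieldNormedType.Exports.

Local Open Scope classical_set_scope.
Local Open Scope ring_scope.

(** Let m(a) be the Fourier transform at a of Lebesgue measure on [t, t + 1].
   With c = 2 t + 1 it is m(a) = e^(i pi a c) sinc(a), and the inner product of
   e_l and e_l' in L^2(rho) is (m(a) + m(b)) / 2, where (a, b) = l - l'.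

   Suppose c = 1 / n with n >= 1 an integer (n = 1 when t = 0). The sum
   m(a) + m(b) vanishes only if a and b are nonzero integers or
   (a, b) = k (n / 2, - n / 2) for an integer k ([transform_zero]); so any two
   points of a spectrum differ by a vector of one of these two kinds.

   The differences with a fixed point l0 are not all integral: otherwise the
   function that is e_l0 on the horizontal leg and - e_l0 on the vertical one
   would be orthogonal to every e_l ([integral_differences_not_dense]). So some
   point l1 has l0 - l1 = k (n / 2, - n / 2) with k n odd, and comparing
   every other point with both l0 and l1 puts the whole spectrum on
   l0 + Z (n / 2, - n / 2) ([spectrum_antidiagonal]).

   On such a set the exponentials are e_l0 times functions of x - y, and x - y
   takes the same value at (x, 0) and at (0, - x). When t < 0 both points lie
   on the support for 0 < x <= - t, so the function equal to e_l0 on one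
   stretch and to - e_l0 on its mirror image is orthogonal to all of them
   ([antidiagonal_not_dense]): rho is not spectral.

   When t = 0 the map x - y is one-to-one on the support and carries rho to the
   uniform measure on [-1, 1], for which the functions e^(i pi k s) form a
   basis. This gives the spectrum Z (1 / 2, - 1 / 2) ([spectrum0]). Every other
   spectrum lies in a translate of it by the above, and it is the full
   translate, because a missing point would give an exponential orthogonal to
   all the others ([spectrum0_shape]).

   Density of the trigonometric polynomials is derived from a density criterion
   for algebras of bounded functions ([approximable_L2]): the measurable sets
   whose indicator is in the L^2-closure of the algebra form a sigma-algebra
   which contains the sublevel sets of the members of the algebra, and when it
   contains every measurable set the closure contains the simple functions,
   hence all of L^2. *)

(** * Complex square-integrable functions *)

Definition sqmodulus (R : realType) (z : R[i]) : R := complex.Re z ^+ 2 + complex.Im z ^+ 2.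

Section L2_squares.
Context d (T : measurableType d) (R : realType).
Variable mu : {measure set T -> \bar R}.

Lemma sqmodulus_ge0 (z : R[i]) : 0 <= sqmodulus z.
Proof. by rewrite addr_ge0 ?sqr_ge0. Qed.

Lemma L2norm_sqr (f : T -> R[i]) :
  (L2norm mu f `^ 2 = \int[mu]_x (sqmodulus (f x))%:E)%E.
Proof.
rewrite /L2norm poweR_Lnorm ?pnatr_eq0//; apply: eq_integral => x _.
rewrite /sqmodulus; case: (f x) => a b /=.
rewrite ger0_norm ?sqrtr_ge0// powR_mulrn ?sqrtr_ge0// sqr_sqrtr//.
by rewrite addr_ge0 ?sqr_ge0.
Qed.

Lemma L2norm_lt (f : T -> R[i]) (e : R) : 0 < e ->
  (L2norm mu f < e%:E)%E <-> (\int[mu]_x (sqmodulus (f x))%:E < (e ^+ 2)%:E)%E.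
Proof.
move=> e0; rewrite -L2norm_sqr.
have N0 : (0 <= L2norm mu f)%E by exact: Lnorm_ge0.
have e2 : (e ^+ 2)%:E = (e%:E `^ 2)%E by rewrite poweR_EFin powR_mulrn// ltW.
have in0y (y : \bar R) : (0 <= y)%E -> y \in `[0%E, +oo%E].
  by move=> y0; rewrite in_itv/= leey andbT.
rewrite e2 !ltNge; split; apply: contraNN => h.
- have r0 : 0 <= 2^-1 :> R by [].
  have := gt0_ler_poweR r0 (in0y _ (poweR_ge0 _ _)) (in0y _ (poweR_ge0 _ _)) h.
  by rewrite -!poweRrM mulfV ?pnatr_eq0// !poweRe1// lee_fin ltW.
- apply: (gt0_ler_poweR _ (in0y _ _) (in0y _ _) h) => //.
  by rewrite lee_fin ltW.
Qed.

Lemma L2norm_lty (f : T -> R[i]) :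
  (L2norm mu f < +oo)%E <-> (\int[mu]_x (sqmodulus (f x))%:E < +oo)%E.
Proof.
rewrite -L2norm_sqr; split; [exact: poweR_lty|apply: lty_poweRy].
by rewrite pnatr_eq0.
Qed.

End L2_squares.

(** * Bounded measurable functions *)

Definition bounded_measurable d (T : measurableType d) (R : realType)
    (f : T -> R) :=
  measurable_fun setT f /\ exists M : R, forall x, `|f x| <= M.

Section bounded_measurable.
Context d (T : measurableType d) (R : realType).
Implicit Types f g : T -> R.

Lemma bm_cst (c : R) : bounded_measurable (cst c : T -> R).
Proof. by split => //; exists `|c|. Qed.

Lemma bmD f g : bounded_measurable f -> bounded_measurable g ->
  bounded_measurable (f \+ g).
Proof.
move=> [mf [M fM]] [mg [N gN]]; split; first exact: measurable_funD.
by exists (M + N) => x /=; apply: le_trans (ler_normD _ _) _; exact: lerD.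
Qed.

Lemma bmN f : bounded_measurable f -> bounded_measurable (\- f).
Proof.
move=> [mf [M fM]]; split; first exact: measurable_funN.
by exists M => x /=; rewrite normrN.
Qed.

Lemma bmB f g : bounded_measurable f -> bounded_measurable g ->
  bounded_measurable (f \- g).
Proof. by move=> bf /bmN bg; exact: bmD bf bg. Qed.

Lemma bmM f g : bounded_measurable f -> bounded_measurable g ->
  bounded_measurable (f \* g).
Proof.
move=> [mf [M fM]] [mg [N gN]]; split; first exact: measurable_funM.
by exists (M * N) => x /=; rewrite normrM ler_pM.
Qed.

Lemma bm_comp d' (T' : measurableType d') (f : T -> R) (h : T' -> T) :
  measurable_fun setT h -> bounded_measurable f -> bounded_measurable (f \o h).
Proof.
move=> mh [mf [M fM]]; split; first exact: measurableT_comp.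
by exists M => x /=.
Qed.

Lemma bm_indic (B : set T) : measurable B -> bounded_measurable (\1_B : T -> R).
Proof.
move=> mB; split; first exact: measurable_indic.
exists 1 => x; rewrite indicE.
by case: (x \in B); rewrite ?normr1 ?normr0.
Qed.

Lemma bm_cos (f : T -> R) : measurable_fun setT f ->
  bounded_measurable (fun x => cos (f x)).
Proof.
move=> mf; split.
  by apply: (measurableT_comp _ mf); apply: continuous_measurable_fun; exact: continuous_cos.
by exists 1 => x; rewrite ler_norml cos_geN1 cos_le1.
Qed.

Lemma bm_sin (f : T -> R) : measurable_fun setT f ->
  bounded_measurable (fun x => sin (f x)).
Proof.
move=> mf; split.
  by apply: (measurableT_comp _ mf); apply: continuous_measurable_fun; exact: continuous_sin.
by exists 1 => x; rewrite ler_norml sin_geN1 sin_le1.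
Qed.

Lemma bm_integrable (mu : {finite_measure set T -> \bar R}) f :
  bounded_measurable f -> mu.-integrable setT (EFin \o f).
Proof.
move=> [mf [M fM]]; apply: measurable_bounded_integrable => //.
  by rewrite -ge0_fin_numE ?fin_num_measure.
by exists M; split; [exact: num_real|move=> x Mx y _; exact: le_trans (fM y) (ltW Mx)].
Qed.

Lemma bm_integral (mu : {finite_measure set T -> \bar R}) f :
  bounded_measurable f ->
  (\int[mu]_x (f x)%:E)%E = (Rintegral mu setT f)%:E.
Proof.
by move=> bf; rewrite /Rintegral fineK//; apply: integrable_fin_num => //;
  exact: bm_integrable.
Qed.

Lemma Rintegral_addr_cst (P : probability T R) f (c : R) :
  bounded_measurable f ->
  Rintegral P setT (fun x => f x + c) = Rintegral P setT f + c.
Proof.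
move=> bf; rewrite (RintegralD _ (bm_integrable P bf) (bm_integrable P (bm_cst c)))//.
rewrite Rintegral_cst// -[in RHS](mulr1 c); congr (_ + c * _).
exact: (f_equal fine (probability_setT P)).
Qed.

End bounded_measurable.

(** * Integration against restricted measures and against rho *)

Section restriction.
Context d (T : measurableType d) (R : realType).
Variables (mu : {measure set T -> \bar R}) (D : set T) (mD : measurable D).

(** The complement of D is a null set for the restriction to D, and the two
   measures agree on the measurable subsets of D. *)
Lemma integral_mrestr (f : T -> \bar R) : measurable_fun setT f ->
  (\int[mrestr mu mD]_x f x = \int[mu]_(x in D) f x)%E.
Proof.
have ge0 g : (forall x, (0 <= g x)%E) -> measurable_fun setT g ->
    (\int[mrestr mu mD]_x g x = \int[mu]_(x in D) g x)%E.
  move=> g0 mg; have mgD : measurable_fun D g by exact: measurable_funTS.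
  have mDC := measurableC mD.
  transitivity (\int[mrestr mu mD]_(x in D) g x)%E.
    rewrite (@ge0_negligible_integral _ _ _ _ setT (~` D))//.
      by rewrite setTD setCK.
    by have : mu (~` D `&` D) = 0%E by rewrite setICl measure0.
  apply: eq_measure_integral => A mA AD.
  exact: (congr1 mu (setIidl AD)).
move=> mf; rewrite [LHS]integralE [in RHS]integralE ge0 ?ge0//.
- exact: measurable_funeneg.
- exact: measurable_funepos.
Qed.

End restriction.

Section rho_integral.
Context {R : realType} (t : R).
Local Notation leb := (@lebesgue_measure R).

Lemma integral_lebI (f : measurableTypeR R -> \bar R) : measurable_fun setT f ->
  (\int[lebI t]_x f x = \int[leb]_(x in `[t, (t + 1)%R]) f x)%E.
Proof. exact: integral_mrestr. Qed.

Lemma measurable_axis1 : measurable_fun setT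
  (fun x : measurableTypeR R => (x, 0) : plane R).
Proof. exact: measurable_fun_pair. Qed.

Lemma measurable_axis2 : measurable_fun setT
  (fun y : measurableTypeR R => (0, y) : plane R).
Proof. exact: measurable_fun_pair. Qed.

(** Tonelli, with the inner integral against the Dirac mass. *)
Lemma ge0_integral_rho (F : plane R -> \bar R) :
  measurable_fun setT F -> (forall p, (0 <= F p)%E) ->
  (\int[rho t]_p F p = 2^-1%:E *
    (\int[lebI t]_x F (x, 0%R) + \int[lebI t]_y F (0%R, y)))%E.
Proof.
move=> mF F0; rewrite /rho ge0_integral_mscale//; congr (_ * _)%E.
rewrite ge0_integral_measure_add//; congr (_ + _)%E.
- rewrite fubini_tonelli1//; apply: eq_integral => x _.
  rewrite /fubini_F integral_dirac ?diracT ?mul1e//.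
  by apply: measurableT_comp => //; exact: measurable_fun_pair.
- rewrite fubini_tonelli2//; apply: eq_integral => y _.
  rewrite /fubini_G integral_dirac ?diracT ?mul1e//.
  by apply: measurableT_comp => //; exact: measurable_fun_pair.
Qed.

Let RI (f : measurableTypeR R -> R) := Rintegral leb `[t, t + 1] f.

Lemma Rintegral_lebI (f : measurableTypeR R -> R) : measurable_fun setT f ->
  Rintegral (lebI t) setT f = RI f.
Proof.
by move=> mf; rewrite /RI /Rintegral integral_lebI//; exact/measurable_EFinP.
Qed.

Lemma Rintegral_rho (F : plane R -> R) : bounded_measurable F ->
  Rintegral (rho t) setT F = 2^-1 *
    (RI (fun x => F (x, 0)) + RI (fun y => F (0, y))).
Proof.
(* A bounded function becomes nonnegative after adding a constant. *)
have ge0 G : bounded_measurable G -> (forall p, 0 <= G p) ->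
    Rintegral (rho t) setT G = 2^-1 *
      (Rintegral (lebI t) setT (fun x => G (x, 0)) +
       Rintegral (lebI t) setT (fun y => G (0, y))).
  move=> bG G0; rewrite {1}/Rintegral ge0_integral_rho//; last first.
    by apply/measurable_EFinP; exact: bG.1.
  rewrite (@bm_integral _ _ _ _ (fun x => G (x, 0))); last first.
    exact: bm_comp measurable_axis1 bG.
  rewrite (@bm_integral _ _ _ _ (fun y => G (0, y))); last first.
    exact: bm_comp measurable_axis2 bG.
  by [].
move=> bF; have [M FM] := bF.2.
have bFM : bounded_measurable (F \+ cst M) by apply: bmD => //; exact: bm_cst.
have b1 := bm_comp measurable_axis1 bF.
have b2 := bm_comp measurable_axis2 bF.
have h p : 0 <= F p + M by have := FM p; rewrite ler_norml; lra.
have hE := ge0 _ bFM h; move: hE; rewrite /= !Rintegral_addr_cst// => hE.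
rewrite -(Rintegral_lebI b1.1) -(Rintegral_lebI b2.1).
by apply: (addIr M); rewrite hE; field.
Qed.

End rho_integral.

(** * Integrals of cosines and sines *)

Section trig_integrals.
Context {R : realType}.
Local Notation leb := (@lebesgue_measure R).

Lemma Rintegral_FTC (f F : R -> R) (u v : R) : u < v ->
  continuous f -> (forall x : R, is_derive x 1 F (f x)) ->
  Rintegral leb `[u, v] f = F v - F u.
Proof.
move=> uv cf dF; rewrite /Rintegral (@continuous_FTC2 _ f F)//.
- exact: continuous_subspaceT.
- have cF : continuous F.
    move=> x; apply: differentiable_continuous; apply/derivable1_diffP.
    exact: (@ex_derive _ _ _ _ _ _ _ (dF x)).
  split.
  + by move=> x _; exact: (@ex_derive _ _ _ _ _ _ _ (dF x)).
  + exact/cvg_at_right_filter/cF.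
  + exact/cvg_at_left_filter/cF.
- by move=> x _; rewrite derive1E; exact: (@derive_val _ _ _ _ _ _ _ (dF x)).
Qed.

Let dscale (w x : R) : is_derive x 1 (fun y => w * y) w.
Proof.
have d : is_derive x 1 (w \*: (@idfun R)) (w *: (1 : R)) by exact: is_deriveZ.
by apply: (is_derive_eq d); rewrite /GRing.scale/= mulr1.
Qed.

Let cscale (g : R -> R) (w : R) : continuous g -> continuous (fun y => g (w * y)).
Proof.
move=> cg x; apply: (cvg_comp (fun y => w * y) g); last exact: cg.
by apply: cvgM; [exact: cvg_cst|exact: cvg_id].
Qed.

Lemma Rintegral_cos (w u v : R) : w != 0 -> u < v ->
  Rintegral leb `[u, v] (fun x => cos (w * x)) =
  (sin (w * v) - sin (w * u)) / w.
Proof.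
move=> w0 uv; pose F y := w^-1 * sin (w * y).
have dF (x : R) : is_derive x 1 F (cos (w * x)).
  have d2 : is_derive x 1 (sin \o (fun y => w * y)) (cos (w * x) * w).
    exact: is_derive1_comp.
  have d3 : is_derive x 1 (w^-1 \*: (sin \o (fun y => w * y))) (w^-1 *: (cos (w * x) * w)).
    exact: is_deriveZ.
  by apply: (is_derive_eq d3); rewrite /GRing.scale/=; field.
rewrite (Rintegral_FTC uv (@cscale cos w (@continuous_cos R)) dF) /F.
by field.
Qed.

Lemma Rintegral_sin (w u v : R) : w != 0 -> u < v ->
  Rintegral leb `[u, v] (fun x => sin (w * x)) =
  (cos (w * u) - cos (w * v)) / w.
Proof.
move=> w0 uv; pose F y := (- w^-1) * cos (w * y).
have dF (x : R) : is_derive x 1 F (sin (w * x)).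
  have d2 : is_derive x 1 (cos \o (fun y => w * y)) (- sin (w * x) * w).
    exact: is_derive1_comp.
  have d3 : is_derive x 1 ((- w^-1) \*: (cos \o (fun y => w * y)))
      ((- w^-1) *: (- sin (w * x) * w)).
    exact: is_deriveZ.
  by apply: (is_derive_eq d3); rewrite /GRing.scale/=; field.
rewrite (Rintegral_FTC uv (@cscale sin w (@continuous_sin R)) dF) /F.
by field.
Qed.

End trig_integrals.

(** * Density in L^2 of an algebra of bounded functions *)

Section density.
Context d (T : measurableType d) (R : realType) (P : probability T R).
Variable A : set (T -> R).

Record bounded_algebra : Prop := BoundedAlgebra {
  bounded_algebra_bm : forall q, A q -> bounded_measurable q;
  bounded_algebra_cst : forall c : R, A (cst c);
  bounded_algebraD : forall p q, A p -> A q -> A (p \+ q);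
  bounded_algebraM : forall p q, A p -> A q -> A (p \* q) }.

Hypothesis algA : bounded_algebra.

Let Am q : A q -> measurable_fun setT q.
Proof. by move=> /(bounded_algebra_bm algA)[]. Qed.

Let Ab q : A q -> exists M : R, forall x, `|q x| <= M.
Proof. by move=> /(bounded_algebra_bm algA)[]. Qed.

Let Acst (c : R) : A (cst c). Proof. exact: bounded_algebra_cst. Qed.

Let AD p q : A p -> A q -> A (p \+ q). Proof. exact: bounded_algebraD. Qed.

Let AM p q : A p -> A q -> A (p \* q). Proof. exact: bounded_algebraM. Qed.

(** Squared distances avoid both square roots and Minkowski's inequality:
   (u + v)^2 <= 2 (u^2 + v^2) is all that limits and sums require. *)
Definition sqdist (f g : T -> R) : \bar R := (\int[P]_x ((f x - g x) ^+ 2)%:E)%E.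

Definition approximable (f : T -> R) :=
  measurable_fun setT f /\
  forall e : R, 0 < e -> exists2 q, A q & (sqdist f q < e%:E)%E.

Let msq (f g : T -> R) : measurable_fun setT f -> measurable_fun setT g ->
  measurable_fun setT (fun x : T => ((f x - g x) ^+ 2)%:E).
Proof.
by move=> mf mg; apply/measurable_EFinP/measurable_funX; exact: measurable_funB.
Qed.

Let sq_ge0 (f g : T -> R) x : (0 <= ((f x - g x) ^+ 2)%:E)%E.
Proof. by rewrite lee_fin sqr_ge0. Qed.

Lemma sqdist_le (f g u v : T -> R) (k : R) : 
  measurable_fun setT f -> measurable_fun setT g ->
  measurable_fun setT u -> measurable_fun setT v -> 0 <= k ->
  (forall x, (f x - g x) ^+ 2 <= k * (u x - v x) ^+ 2) ->
  (sqdist f g <= k%:E * sqdist u v)%E.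
Proof.
move=> mf mg mu mv k0 h.
rewrite /sqdist -ge0_integralZl//; [|exact: msq].
apply: ge0_le_integral => //; first exact: msq.
  by apply: emeasurable_funM => //; exact: msq.
by move=> x _; rewrite -EFinM lee_fin.
Qed.

Lemma sqdist_le2 (f g u v w z : T -> R) (k : R) : 
  measurable_fun setT f -> measurable_fun setT g ->
  measurable_fun setT u -> measurable_fun setT v ->
  measurable_fun setT w -> measurable_fun setT z ->
  0 <= k ->
  (forall x, (f x - g x) ^+ 2 <= k * ((u x - v x) ^+ 2 + (w x - z x) ^+ 2)) ->
  (sqdist f g <= k%:E * (sqdist u v + sqdist w z))%E.
Proof.
move=> mf mg mu mv mw mz k0 h.
rewrite /sqdist -ge0_integralD//; [|exact: msq|exact: msq].
have mm : measurable_fun setT 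
  (fun x : T => ((u x - v x) ^+ 2)%:E + ((w x - z x) ^+ 2)%:E)%E.
  by apply: emeasurable_funD; exact: msq.
rewrite -ge0_integralZl//; last by move=> x _; exact: adde_ge0.
apply: ge0_le_integral => //; first exact: msq.
  by apply: emeasurable_funM.
by move=> x _; rewrite -EFinD -EFinM lee_fin.
Qed.

Lemma approximable_alg q : A q -> approximable q.
Proof.
move=> Aq; split; first exact: Am.
move=> e e0; exists q => //; rewrite /sqdist.
under eq_integral do rewrite subrr expr0n/=.
by rewrite integral0 lte_fin.
Qed.

Lemma approximable_lim f : measurable_fun setT f ->
  (forall e : R, 0 < e -> exists2 g, approximable g & (sqdist f g < e%:E)%E) ->
  approximable f.
Proof.
move=> mf H; split=> // e e0.
have e4 : 0 < e / 4 by lra.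
have [g [mg /(_ _ e4)[q Aq gq]] fg] := H _ e4.
exists q => //.
apply: (@le_lt_trans _ _ (2%:E * (sqdist f g + sqdist g q))%E).
  apply: sqdist_le2 => //; first exact: Am; first exact: Am.
  by move=> x; have := sqr_ge0 (f x - 2 * g x + q x); rewrite !expr2; lra.
have -> : e%:E = (2%:E * ((e / 4)%:E + (e / 4)%:E))%E.
  by rewrite -EFinD -EFinM; congr EFin; lra.
by rewrite lte_pmul2l//; exact: lteD.
Qed.

Lemma approximableD f g : approximable f -> approximable g ->
  approximable (f \+ g).
Proof.
move=> [mf Hf] [mg Hg]; split; first exact: measurable_funD.
move=> e e0; have e4 : 0 < e / 4 by lra.
have [p Ap fp] := Hf _ e4; have [q Aq gq] := Hg _ e4.
exists (p \+ q); first exact: AD.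
apply: (@le_lt_trans _ _ (2%:E * (sqdist f p + sqdist g q))%E).
  apply: sqdist_le2 => //; try exact: Am; try exact: measurable_funD.
    by apply: measurable_funD; exact: Am.
  move=> x /=; have := sqr_ge0 (f x - p x - (g x - q x)); rewrite !expr2; lra.
have -> : e%:E = (2%:E * ((e / 4)%:E + (e / 4)%:E))%E.
  by rewrite -EFinD -EFinM; congr EFin; lra.
by rewrite lte_pmul2l//; exact: lteD.
Qed.

Lemma sqdistM_le (M : R) (u f g : T -> R) : (forall x, `|u x| <= M) ->
  measurable_fun setT u -> measurable_fun setT f -> measurable_fun setT g ->
  (sqdist (u \* f)%R (u \* g)%R <= (M ^+ 2)%:E * sqdist f g)%E.
Proof.
move=> uM mu mf mg; apply: sqdist_le => //; try exact: measurable_funM.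
  exact: sqr_ge0.
move=> x /=; rewrite -mulrBr exprMn ler_wpM2r ?sqr_ge0//.
rewrite -(real_normK (num_real (u x))) lerXn2r ?nnegrE//.
exact: le_trans (uM x).
Qed.

Lemma approximableM_alg q f : A q -> approximable f -> approximable (q \* f).
Proof.
move=> Aq [mf Hf]; have mq := Am Aq; split; first exact: measurable_funM.
move=> e e0; have [M qM] := Ab Aq.
have M0 : 0 < M ^+ 2 + 1 by rewrite ltr_wpDl ?sqr_ge0.
have [p Ap fp] := Hf (e / (M ^+ 2 + 1)) (divr_gt0 e0 M0).
exists (q \* p); first exact: AM.
apply: le_lt_trans (sqdistM_le qM mq mf (Am Ap)) _.
apply: (@le_lt_trans _ _ ((M ^+ 2 + 1)%:E * sqdist f p)%E).
  by rewrite lee_wpmul2r ?integral_ge0// lee_fin lerDl.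
have -> : e%:E = ((M ^+ 2 + 1)%:E * (e / (M ^+ 2 + 1))%:E)%E.
  by rewrite -EFinM mulrCA mulfV ?mulr1// gt_eqF.
by rewrite lte_pmul2l.
Qed.

(** The algebra multiplies approximable functions into approximable ones, so an
   approximable bounded f is multiplied by g through approximants of g: since f
   is bounded, f p is close to f g as soon as p is close to g. *)
Lemma approximableM (M : R) f g : (forall x, `|f x| <= M) ->
  approximable f -> approximable g -> approximable (f \* g).
Proof.
move=> fM af [mg Hg]; have mf := af.1; apply: approximable_lim.
  exact: measurable_funM.
move=> e e0.
have M0 : 0 < M ^+ 2 + 1 by rewrite ltr_wpDl ?sqr_ge0.
have [p Ap gp] := Hg (e / (M ^+ 2 + 1)) (divr_gt0 e0 M0).
exists (f \* p).
  rewrite (_ : f \* p = p \* f); first exact: approximableM_alg.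
  by apply/funext => x /=; rewrite mulrC.
apply: le_lt_trans (sqdistM_le fM mf mg (Am Ap)) _.
apply: (@le_lt_trans _ _ ((M ^+ 2 + 1)%:E * sqdist g p)%E).
  by rewrite lee_wpmul2r ?integral_ge0// lee_fin lerDl.
have -> : e%:E = ((M ^+ 2 + 1)%:E * (e / (M ^+ 2 + 1))%:E)%E.
  by rewrite -EFinM mulrCA mulfV ?mulr1// gt_eqF.
by rewrite lte_pmul2l.
Qed.

Lemma approximableZ (c : R) f : approximable f -> approximable (c \*o f).
Proof. exact: approximableM_alg (Acst c). Qed.

(** Dominated convergence applied to the squared differences. *)
Lemma approximable_cvg (f_ : (T -> R)^nat) (f h : T -> R) :
  (forall n, approximable (f_ n)) -> measurable_fun setT f ->
  (forall x, f_ ^~ x @ \oo --> f x) ->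
  P.-integrable setT (EFin \o h) ->
  (forall n x, (f x - f_ n x) ^+ 2 <= h x) ->
  approximable f.
Proof.
move=> af mf ff ih fh; apply: approximable_lim => // e e0.
have mD n : measurable_fun setT (fun x => ((f x - f_ n x) ^+ 2)%:E).
  by apply: msq => //; exact: (af n).1.
have cvD x : (((f x - f_ n x) ^+ 2)%:E @[n --> \oo] --> 0%E)%classic.
  apply/fine_cvgP; split; first exact: nearW.
  suff : ((f x - f_ n x) ^+ 2 @[n --> \oo] --> (f x - f x) ^+ 2)%classic.
    by rewrite subrr expr0n.
  apply: (cvg_comp (fun n => f x - f_ n x) (fun y => y ^+ 2)).
    by apply: cvgB (ff x); exact: cvg_cst.
  exact: exprn_continuous.
have aecv : {ae P, forall x, setT x ->
    ((f x - f_ n x) ^+ 2)%:E @[n --> \oo] --> 0%E} by exact: aeW.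
have aeh : {ae P, forall x n, setT x ->
    (`|((f x - f_ n x) ^+ 2)%:E| <= (EFin \o h) x)%E}.
  by apply: aeW => x n _ /=; rewrite lee_fin ger0_norm ?sqr_ge0.
have [_ _ cv] := dominated_convergence measurableT mD
  (measurable_cst 0%E) aecv ih aeh.
have {}cv : (sqdist f (f_ n) @[n --> \oo] --> 0%E)%classic.
  by move: cv; rewrite integral0.
have /fine_cvgP[finD /cvgr_lt/(_ e e0) fineD] := cv.
have [n _ /(_ n (leqnn _))[/= finn fn]] := filterI finD fineD.
by exists (f_ n) => //; rewrite -(fineK finn) lte_fin.
Qed.

Definition approximable_set (B : set T) :=
  measurable B /\ approximable (\1_B : T -> R).

Let indic_le1 (B : set T) x : `|\1_B x : R| <= 1.
Proof. by rewrite indicE; case: (x \in B); rewrite ?normr1 ?normr0. Qed.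

Lemma approximable_setC B : approximable_set B -> approximable_set (~` B).
Proof.
move=> [mB aB]; split; first exact: measurableC.
have -> : \1_(~` B) = cst 1 \+ (-1 \*o (\1_B : T -> R)).
  apply/funext => x /=; rewrite !indicE in_setC.
  by case: (x \in B) => /=; ring.
by apply: approximableD; [exact/approximable_alg|exact: approximableZ].
Qed.

Lemma approximable_setI B C : approximable_set B -> approximable_set C ->
  approximable_set (B `&` C).
Proof.
move=> [mB aB] [mC aC]; split; first exact: measurableI.
have -> : \1_(B `&` C) = (\1_B : T -> R) \* \1_C.
  apply/funext => x /=; rewrite !indicE in_setI.
  by case: (x \in B); case: (x \in C); rewrite /= ?mulr1 ?mulr0.
exact: approximableM (@indic_le1 B) aB aC.
Qed.

Lemma approximable_set0 : approximable_set set0.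
Proof.
split; first exact: measurable0.
have -> : \1_set0 = cst (0 : R) :> (T -> R) by rewrite indic0.
exact/approximable_alg.
Qed.

Lemma approximable_setU B C : approximable_set B -> approximable_set C ->
  approximable_set (B `|` C).
Proof.
move=> aB aC; rewrite -[X in approximable_set X]setCK setCU.
by apply/approximable_setC/approximable_setI; exact: approximable_setC.
Qed.

Let integrable_cst (c : R) : P.-integrable setT (EFin \o cst c).
Proof. exact: finite_measure_integrable_cst. Qed.

Lemma approximable_bigcup (F : (set T)^nat) :
  (forall n, approximable_set (F n)) -> approximable_set (\bigcup_k F k).
Proof.
move=> aF; have mF : measurable (\bigcup_k F k).
  by apply: bigcupT_measurable => k; exact: (aF k).1.
split => //.
pose G n := \big[setU/set0]_(k < n) F k.
have aG n : approximable_set (G n).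
  by rewrite /G; elim/big_ind : _ => //;
    [exact: approximable_set0|exact: approximable_setU].
apply: (@approximable_cvg (fun n => \1_(G n)) _ (cst 1)) => //.
- by move=> n; exact: (aG n).2.
- move=> x; apply: cvg_near_cst.
  have [[k _ Fkx]|nFx] := pselect ((\bigcup_k F k) x).
    exists k.+1 => // n /= kn; rewrite !indicE !mem_set//; first by exists k.
    by rewrite /G -bigcup_mkord; exists k.
  apply: nearW => n; rewrite !indicE !memNset// /G -bigcup_mkord.
  by move=> [k _ Fkx]; apply: nFx; exists k.
- move=> n x /=; rewrite !indicE.
  by case: (_ \in _); case: (_ \in _); rewrite /= ?subrr ?subr0 ?sub0r ?sqrrN
    ?expr0n ?expr1n ?ler01.
Qed.

(** Complements come from 1 - u, intersections from products, and countable
   unions from the pointwise limit of the indicators of the partial unions. *)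
Lemma approximable_sigma_algebra : sigma_algebra setT approximable_set.
Proof.
split; [exact: approximable_set0| |exact: approximable_bigcup].
by move=> B; rewrite setTD; exact: approximable_setC.
Qed.

(** The odd cubic fixing 0 and 1, with derivative 0 at 1: its iterates converge
   on [-1, 1] to the sign function, so that polynomials applied to a member of
   the algebra reach the indicators of its sublevel sets. *)
Let p (x : R) := (3 * x - x ^+ 3) / 2.

Let pN x : p (- x) = - p x. Proof. by rewrite /p; field. Qed.

Let iterpN n x : iter n p (- x) = - iter n p x.
Proof. by elim: n => //= n ->. Qed.

(** Convergence is geometric because 1 - p(y) = (1 - y)^2 (1 + y / 2), which is
   at most (1 - y) (1 - y / 2), and because the iterates of x stay above x. *)
Let iterp_itv n x : 0 < x <= 1 ->
  x <= iter n p x <= 1 /\ 1 - iter n p x <= (1 - x / 2) ^+ n.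
Proof.
move=> /andP[x0 x1]; elim: n => [|n [/andP[xy y1] IH]] /=.
  by rewrite lexx x1 expr0; split => //; lra.
set y := iter n p x in xy y1 IH *; have y0 : 0 < y by exact: lt_le_trans xy.
have pE : 1 - p y = (1 - y) ^+ 2 * (1 + y / 2) by rewrite /p; field.
have pyE : p y = y * (1 + (1 - y ^+ 2) / 2) by rewrite /p; field.
split.
  apply/andP; split.
    apply: le_trans xy _; rewrite pyE ler_peMr ?(ltW y0)//.
    by rewrite lerDl divr_ge0// subr_ge0 expr_le1 // ltW.
  by rewrite -subr_ge0 pE mulr_ge0 ?sqr_ge0//; lra.
rewrite pE expr2 -mulrA exprSr.
apply: (@le_trans _ _ ((1 - y) * (1 - x / 2))).
  by apply: ler_wpM2l; [lra|nra].
by apply: ler_wpM2r IH; lra.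
Qed.

Let iterp_cvg x : -1 <= x <= 1 ->
  (iter n p x @[n --> \oo] --> Num.sg x)%classic.
Proof.
have pos y : 0 < y <= 1 -> (iter n p y @[n --> \oo] --> (1 : R))%classic.
  move=> y01; have /andP[y0 y1] := y01.
  apply/cvgrPdist_le => e e0.
  have /cvgrPdist_le/(_ e e0) : (geometric 1 (1 - y / 2) n @[n --> \oo] --> 0)%classic.
    by apply: cvg_geometric; rewrite ger0_norm; lra.
  apply: filterS => n /=; have [/andP[_ h1] h2] := iterp_itv n y01.
  rewrite sub0r normrN mul1r ger0_norm; last by rewrite exprn_ge0//; lra.
  by apply: le_trans; rewrite ger0_norm ?subr_ge0.
move=> /andP[x1 x2]; have [x0|x0|->] := ltrgt0P x.
- by rewrite gtr0_sg//; apply: pos; rewrite x0.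
- rewrite ltr0_sg//.
  have -> : (fun n => iter n p x) = (fun n => - iter n p (- x)).
    by apply/funext => n; rewrite iterpN opprK.
  have Nx : 0 < - x <= 1 by lra.
  exact: (cvgN (pos _ Nx)).
- rewrite sgr0; apply: cvg_near_cst; apply: nearW => n.
  by elim: n => //= n ->; rewrite /p; field.
Qed.

Let iterp_le1 n x : -1 <= x <= 1 -> `|iter n p x| <= 1.
Proof.
move=> /andP[x1 x2]; have [x0|x0|->] := ltrgt0P x.
- have /(iterp_itv n)[/andP[h1 h2] _] : 0 < x <= 1 by rewrite x0.
  by rewrite ger0_norm//; lra.
- have /(iterp_itv n) : 0 < - x <= 1 by lra.
  rewrite iterpN => -[/andP[h1 h2] _].
  by rewrite -normrN ger0_norm//; lra.
- suff -> : iter n p 0 = 0 by rewrite normr0.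
  by elim: n => //= n ->; rewrite /p; field.
Qed.

Let iterp_alg n q : A q -> A (fun x => iter n p (q x)).
Proof.
move=> Aq; elim: n => //= n IH; set u := fun x => _ in IH.
have -> : (fun x => p (iter n p (q x))) =
    (cst (3 / 2) \* u) \+ (cst (- 2^-1) \* (u \* (u \* u))).
  by apply/funext => x /=; rewrite /p -/(u x); field.
by apply: AD; apply: AM => //; do ?apply: AM.
Qed.

Let sg_norm_le1 (x : R) : `|Num.sg x| <= 1.
Proof. by rewrite normr_sg; case: (x != 0). Qed.

Let approximable_sg q : A q -> (forall x, -1 <= q x <= 1) ->
  approximable (fun x => Num.sg (q x)).
Proof.
move=> Aq q1.
have msg : measurable_fun setT (fun x => Num.sg (q x)).
  apply: (@measurable_fun_cvg _ _ _ setT (fun n x => iter n p (q x))) => //.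
    by move=> n; exact/Am/iterp_alg.
  by move=> x _; exact: iterp_cvg.
apply: (@approximable_cvg (fun n x => iter n p (q x)) _ (cst 4)) => //.
- by move=> n; apply/approximable_alg; exact: iterp_alg.
- by move=> x; exact: iterp_cvg.
- move=> n x /=; have := iterp_le1 n (q1 x); have := sg_norm_le1 (q x).
  rewrite !ler_norml => /andP[a b] /andP[a' b'].
  set y := Num.sg _ - _; have : 0 <= (2 - y) * (2 + y).
    by rewrite /y; apply: mulr_ge0; lra.
  by rewrite (_ : (2 - y) * (2 + y) = 4 - y ^+ 2) ?subr_ge0//; ring.
Qed.

(** After rescaling q - c to a function w with values in [-1, 1], the indicator
   is (sg(w)^2 - sg(w)) / 2. *)
Lemma approximable_ltr q c : A q -> approximable_set [set x | q x < c].
Proof.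
move=> Aq; have [M qM] := Ab Aq.
have mS : measurable [set x | q x < c].
  have -> : [set x | q x < c] = setT `&` q @^-1` `]-oo, c[.
    by rewrite setTI; apply/funext => x /=; rewrite in_itv.
  by apply: (Am Aq) => //; exact: measurable_itv.
split => //.
pose K := `|M| + `|c| + 1.
have K0 : 0 < K by rewrite /K ltr_wpDl ?addr_ge0.
pose w x := (q x - c) / K.
have Aw : A w.
  have -> : w = cst K^-1 \* (q \+ cst (- c)).
    by apply/funext => x; rewrite /w /= mulrC.
  by apply: AM => //; exact: AD.
have w1 x : -1 <= w x <= 1.
  rewrite -ler_norml /w normrM normfV (gtr0_norm K0) ler_pdivrMr// mul1r.
  apply: le_trans (ler_normB _ _) _; rewrite /K.
  have := qM x; have := ler_norm M; lra.
have asg := approximable_sg Aw w1.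
have -> : \1_[set x | q x < c] =
   (2^-1 \*o ((fun x => Num.sg (w x)) \* (fun x => Num.sg (w x)))) \+
   (- 2^-1 \*o (fun x => Num.sg (w x))).
  apply/funext => x /=; rewrite indicE.
  have [h|h|h] := ltrgtP (q x) c.
  - by rewrite mem_set//= ltr0_sg ?pmulr_llt0 ?invr_gt0 ?subr_lt0//; field.
  - rewrite memNset/=; last by apply/negP; rewrite -leNgt ltW.
    by rewrite gtr0_sg ?pmulr_lgt0 ?invr_gt0 ?subr_gt0//; field.
  - rewrite memNset/=; last by rewrite h ltxx.
    by rewrite /w h subrr mul0r sgr0; field.
apply: approximableD; apply: approximableZ => //.
by apply: (@approximableM 1) => // x; exact: sg_norm_le1.
Qed.

(** The closure is taken in L^2, where functions count up to null sets. *)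
Lemma approximable_set_ae B C : approximable_set B -> measurable C ->
  {ae P, forall x, B x <-> C x} -> approximable_set C.
Proof.
move=> [mB [m1B aB]] mC BC; split => //; split.
  exact: measurable_indic.
move=> e e0; have [q Aq Bq] := aB _ e0; exists q => //.
suff -> : sqdist \1_C q = sqdist \1_B q by [].
apply: ge0_ae_eq_integral => //.
- by apply: msq; [exact: measurable_indic|exact: Am].
- by apply: msq => //; exact: Am.
- apply: filterS BC => x BC _; congr (((_ - _) ^+ 2)%:E).
  rewrite !indicE; congr (nat_of_bool _)%:R.
  by apply/idP/idP; rewrite !inE => /BC.
Qed.

Hypothesis aset : forall B, measurable B -> approximable_set B.

Import HBSimple HBNNSimple.

Let approximable_nnsfun (f : {nnsfun T >-> R}) : approximable f.
Proof.
have -> : (f : T -> R) =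
  \sum_(y \in range f) (y \*o (\1_(f @^-1` [set y]) : T -> R)).
  apply/funext => x; rewrite fimfunE fsbig_finite//= [in RHS]fsbig_finite//=.
  by rewrite fct_sumE.
rewrite fsbig_finite//=; elim/big_ind : _.
- exact/(approximable_alg (Acst 0)).
- by move=> *; exact: approximableD.
- move=> y _; apply: approximableZ; apply: (aset _).2.
  exact: measurable_sfunP.
Qed.

Let approximable_ge0 (f : T -> R) : measurable_fun setT f -> (forall x, 0 <= f x) ->
  P.-integrable setT (fun x => ((f x) ^+ 2)%:E) -> approximable f.
Proof.
move=> mf f0 if2.
have mEf : measurable_fun setT (EFin \o f) by exact/measurable_EFinP.
pose f_ := nnsfun_approx measurableT mEf.
have ff x : (f_ n x @[n --> \oo] --> f x)%classic.
  have /fine_cvgP[_] := cvg_nnsfun_approx measurableT mEf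
    (fun x _ => f0 x) (I : setT x).
  exact.
apply: (@approximable_cvg f_ f (fun x => f x ^+ 2)) => // n x.
have : f_ n x <= f x.
  rewrite -lee_fin /f_ nnsfun_approxE.
  by apply: le_approx => // y _; rewrite lee_fin.
have : 0 <= f_ n x by [].
move=> a b; rewrite lerXn2r ?nnegrE ?subr_ge0//.
by rewrite lerBlDr lerDl.
Qed.

(** The positive and negative parts of f are increasing limits of simple
   functions, dominated in L^2 by f itself. *)
Lemma approximable_L2 (f : T -> R) : measurable_fun setT f ->
  P.-integrable setT (fun x => ((f x) ^+ 2)%:E) -> approximable f.
Proof.
move=> mf if2.
have -> : f = f^\+ \+ (-1 \*o f^\-).
  apply/funext => x /=; rewrite mulN1r.
  by have /(congr1 (@^~ x))/= <- := funrposBneg f.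
have le2 (g : T -> R) : measurable_fun setT g -> (forall x, `|g x| <= `|f x|) ->
  P.-integrable setT (fun x => ((g x) ^+ 2)%:E).
  move=> mg gf; apply: le_integrable if2 => //.
    by apply/measurable_EFinP; exact: measurable_funX.
  move=> x _; rewrite /= lee_fin !normrX lerXn2r ?nnegrE//.
apply: approximableD; last apply: approximableZ.
- apply: approximable_ge0 => //; first exact: measurable_funrpos.
  apply: le2 => //; first exact: measurable_funrpos.
  move=> x; rewrite (ger0_norm (funrpos_ge0 _ _)).
  have /(congr1 (@^~ x))/= <- := funrposDneg f.
  by rewrite lerDl funrneg_ge0.
- apply: approximable_ge0 => //; first exact: measurable_funrneg.
  apply: le2 => //; first exact: measurable_funrneg.
  move=> x; rewrite (ger0_norm (funrneg_ge0 _ _)).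
  have /(congr1 (@^~ x))/= <- := funrposDneg f.
  by rewrite lerDr funrpos_ge0.
Qed.

End density.

(** * The zeros of the Fourier transform of rho *)

Section integer_multiples_of_pi.
Context {R : realType}.

Lemma sin_intpi (k : int) : sin (k%:~R * pi) = 0 :> R.
Proof.
have pos n : sin (n%:R * pi) = 0 :> R.
  elim: n => [|n IH]; first by rewrite mul0r sin0.
  by rewrite -natr1 mulrDl mul1r sinDpi IH oppr0.
case: k => n; first by rewrite -pmulrn.
by rewrite NegzE mulrNz mulNr sinN -pmulrn pos oppr0.
Qed.

Lemma cos_intpi_sqr (k : int) : cos (k%:~R * pi) ^+ 2 = 1 :> R.
Proof. by rewrite cos2sin2 sin_intpi expr0n subr0. Qed.

Lemma cos_intpi_neq0 (k : int) : cos (k%:~R * pi) != 0 :> R.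
Proof. by rewrite -sqrf_eq0 cos_intpi_sqr oner_eq0. Qed.

(** Subtracting the integer part of x / pi brings x into [0, pi), where the sine
   vanishes only at 0. *)
Lemma sin_eq0_intpi (x : R) : sin x = 0 -> exists k : int, x = k%:~R * pi.
Proof.
move=> sx; have pi0 := pi_gt0 R.
have [k /andP[k1 k2]] : exists k : int, k%:~R <= x / pi < (k + 1)%:~R.
  by exists (Num.floor (x / pi)); exact: real_floor_itv (num_real _).
exists k; have y0 : 0 <= x - k%:~R * pi by rewrite subr_ge0 -ler_pdivlMr.
have y1 : x - k%:~R * pi < pi.
  by rewrite ltrBlDr -[X in X + _]mul1r -mulrDl -ltr_pdivrMr// addrC -intrD1.
have sy : sin (x - k%:~R * pi) = 0.
  by rewrite sinB sx sin_intpi mul0r mulr0 subrr.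
apply/eqP; rewrite -subr_eq0; apply/eqP/le_anti; rewrite y0 andbT leNgt.
apply/negP => y2; have := @sin_gt0_pi R (x - k%:~R * pi).
by rewrite sy ltxx y2 y1 => /(_ isT).
Qed.

End integer_multiples_of_pi.

Section transform.
Context {R : realType}.
Implicit Types (a b c t x : R) (l : R * R).
Local Notation leb := (@lebesgue_measure R).

(** Up to a phase, the Fourier transform of an interval of length 1. *)
Definition sinc x : R := if x == 0 then 1 else sin (pi * x) / (pi * x).

Lemma sinc_int (k : int) : k != 0 -> sinc k%:~R = 0.
Proof. by move=> k0; rewrite /sinc intr_eq0 (negbTE k0) [pi * _]mulrC sin_intpi mul0r. Qed.

Lemma sincN x : sinc (- x) = sinc x.
Proof.
rewrite /sinc oppr_eq0; case: eqP => // _.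
by rewrite mulrN sinN invrN mulrNN.
Qed.

(** The interval has centre (2 t + 1) / 2; its two ends contribute
   sin(A + B) - sin(A - B) = 2 cos(A) sin(B) with B = pi a. *)
Lemma Rintegral_unit_cos t a :
  Rintegral leb `[t, t + 1] (fun x => cos (2 * pi * a * x)) =
  cos (pi * a * (2 * t + 1)) * sinc a.
Proof.
rewrite /sinc; case: eqP => [->|/eqP a0].
  under eq_Rintegral do rewrite mulr0 mul0r cos0.
  have e : leb `[t, t + 1]%classic = 1%E.
    by rewrite lebesgue_measure_itv/= lte_fin ltrDl ltr01 -EFinB addrAC subrr add0r.
  rewrite Rintegral_cst// mulr0 mul0r cos0; congr (1 * _).
  exact: (f_equal fine e).
have pi0 : pi != 0 :> R by rewrite gt_eqF// pi_gt0.
have w0 : 2 * pi * a != 0 by rewrite !mulf_neq0.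
rewrite Rintegral_cos ?ltrDl//.
have -> : 2 * pi * a * (t + 1) = pi * a * (2 * t + 1) + pi * a by ring.
have -> : 2 * pi * a * t = pi * a * (2 * t + 1) - pi * a by ring.
rewrite sinD sinB; move: (@pi R) pi0 {w0} => P P0.
by field; rewrite a0 P0.
Qed.

Lemma Rintegral_unit_sin t a :
  Rintegral leb `[t, t + 1] (fun x => sin (2 * pi * a * x)) =
  sin (pi * a * (2 * t + 1)) * sinc a.
Proof.
rewrite /sinc; case: eqP => [->|/eqP a0].
  under eq_Rintegral do rewrite mulr0 mul0r sin0.
  by rewrite Rintegral_cst// mulr0 !mul0r sin0 mul0r.
have pi0 : pi != 0 :> R by rewrite gt_eqF// pi_gt0.
have w0 : 2 * pi * a != 0 by rewrite !mulf_neq0.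
rewrite Rintegral_sin ?ltrDl//.
have -> : 2 * pi * a * (t + 1) = pi * a * (2 * t + 1) + pi * a by ring.
have -> : 2 * pi * a * t = pi * a * (2 * t + 1) - pi * a by ring.
rewrite cosB cosD; move: (@pi R) pi0 {w0} => P P0.
by field; rewrite a0 P0.
Qed.

Lemma expo_mul_conj l l' (p : plane R) :
  expo l p * conjc (expo l' p) = expo (l - l') p.
Proof.
rewrite /expo /=; set u := 2 * pi * (l.1 * _ + _); set v := 2 * pi * (l'.1 * _ + _).
have -> : 2 * pi * ((l.1 - l'.1) * p.1 + (l.2 - l'.2) * p.2) = u - v.
  by rewrite /u /v; ring.
rewrite cosB sinB; apply/eqP; rewrite eq_complex /=; apply/andP; split; apply/eqP; ring.
Qed.

Lemma measurable_phase l : measurable_fun setT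
  (fun p : plane R => 2 * pi * (l.1 * p.1 + l.2 * p.2)).
Proof.
by apply: measurable_funM => //; apply: measurable_funD; exact: measurable_funM.
Qed.

Lemma bm_expoRe l : bounded_measurable (fun p : plane R => complex.Re (expo l p)).
Proof. exact: (bm_cos (measurable_phase l)). Qed.

Lemma bm_expoIm l : bounded_measurable (fun p : plane R => complex.Im (expo l p)).
Proof. exact: (bm_sin (measurable_phase l)). Qed.

Lemma L2dot_expo t l l' : L2dot (rho t) (expo l) (expo l') =
  let a := l.1 - l'.1 in let b := l.2 - l'.2 in let c := 2 * t + 1 in
  Complex (2^-1 * (cos (pi * a * c) * sinc a + cos (pi * b * c) * sinc b))
          (2^-1 * (sin (pi * a * c) * sinc a + sin (pi * b * c) * sinc b)).
Proof.
have -> : L2dot (rho t) (expo l) (expo l') = cintegral (rho t) (expo (l - l')).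
  by congr cintegral; apply/funext => p; exact: expo_mul_conj.
rewrite /cintegral Rintegral_rho; last exact: bm_expoRe.
rewrite Rintegral_rho; last exact: bm_expoIm.
rewrite /= -!Rintegral_unit_cos -!Rintegral_unit_sin.
by congr (Complex (_ * (_ + _)) (_ * (_ + _))); apply: eq_Rintegral => x _ /=;
  rewrite mulr0 ?addr0 ?add0r !mulrA.
Qed.

(** If the first coordinates differed by d, the quotient of the two functions
   would be -1 at the point (1 / (2 d), 0). *)
Lemma expo_inj : injective (@expo R).
Proof.
move=> [a b] [a' b'] E.
have F (x y : R) : cos (2 * pi * ((a - a') * x + (b - b') * y)) = 1.
  have := expo_mul_conj (a, b) (a', b') (x, y).
  rewrite E expo_mul_conj subrr => /(congr1 (@complex.Re R)) /= <-.
  by rewrite !mul0r addr0 mulr0 cos0.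
have two (d : R) : d != 0 -> cos (2 * pi * (d * (2 * d)^-1)) != 1.
  move=> d0; have -> : 2 * pi * (d * (2 * d)^-1) = pi by move: (@pi R) {E F} => P; field.
  by rewrite cospi lt_eqF// (lt_trans (ltrN10 R) ltr01).
have a0 : a = a'.
  apply/eqP; rewrite -subr_eq0; apply/negPn/negP => /two.
  by have := F (2 * (a - a'))^-1 0; rewrite mulr0 addr0 => -> /eqP.
have b0 : b = b'.
  apply/eqP; rewrite -subr_eq0; apply/negPn/negP => /two.
  by have := F 0 (2 * (b - b'))^-1; rewrite mulr0 add0r => -> /eqP.
by rewrite a0 b0.
Qed.

(** Unless both terms vanish, which makes a and b nonzero integers, they are
   opposite numbers e^(i A) sinc(a) and e^(i B) sinc(b) with sinc(a) and sinc(b)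
   real and nonzero, so A - B is a multiple k pi of pi, that is a - b = k n. Then the
   numerators sin(pi a) and sin(pi b) agree up to sign, and so do a and b; the
   sign that makes them equal is excluded as it forces k = 0, where the signs
   are known. *)
Lemma transform_zero (n : int) a b : 0 < n ->
  let c := 1 / n%:~R in
  cos (pi * a * c) * sinc a + cos (pi * b * c) * sinc b = 0 ->
  sin (pi * a * c) * sinc a + sin (pi * b * c) * sinc b = 0 ->
  (exists j k : int, [/\ j != 0, k != 0, a = j%:~R & b = k%:~R]) \/
  (exists k : int, a = k%:~R * n%:~R / 2 /\ b = - a).
Proof.
move=> n0 c; have pi0 : pi != 0 :> R by rewrite gt_eqF// pi_gt0.
have nz : n%:~R != 0 :> R by rewrite intr_eq0 gt_eqF.
set A := pi * a * c; set B := pi * b * c => hc hs.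
have cs x : cos x = 0 -> sin x = 0 -> False.
  by move=> c0 s0; have := cos2Dsin2 x; rewrite c0 s0 !expr0n addr0 => /eqP; rewrite eq_sym oner_eq0.
have sinc0 x : sinc x = 0 -> exists2 k : int, k != 0 & x = k%:~R.
  rewrite /sinc; case: eqP => [_ /eqP|/eqP x0 /eqP]; first by rewrite oner_eq0.
  rewrite mulf_eq0 invr_eq0 !mulf_eq0 (negbTE pi0) (negbTE x0) !orbF => /eqP.
  move=> /sin_eq0_intpi[k]; rewrite mulrC => /(mulIf pi0) xk.
  by exists k => //; rewrite -(intr_eq0 R) -xk.
have half x y : cos x * y = 0 -> sin x * y = 0 -> y = 0.
  move=> /eqP; rewrite mulf_eq0 => /orP[/eqP c0 /eqP|/eqP//].
  by rewrite mulf_eq0 => /orP[/eqP s0|/eqP//]; case: (cs x).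
have [sa|sa] := eqVneq (sinc a) 0.
  left; have sb : sinc b = 0.
    by move: hc hs; rewrite sa !mulr0 !add0r; exact: half.
  have [j j0 ->] := sinc0 _ sa; have [k k0 ->] := sinc0 _ sb.
  by exists j, k.
have sAB : sin (A - B) = 0.
  apply/eqP; rewrite -(mulIr_eq0 _ (mulIf sa)); apply/eqP.
  have -> : sin (A - B) * sinc a =
     cos B * (sin A * sinc a + sin B * sinc b) -
     sin B * (cos A * sinc a + cos B * sinc b) by rewrite sinB; ring.
  by rewrite hc hs !mulr0 subrr.
right; have [k ABk] := sin_eq0_intpi sAB.
have abk : a - b = k%:~R * n%:~R.
  have : (a - b) * (pi * c) = k%:~R * n%:~R * (pi * c).
    have -> : (a - b) * (pi * c) = A - B by rewrite /A /B; ring.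
    by rewrite ABk /c; field.
  by apply: mulIf; rewrite /c div1r mulf_neq0// invr_eq0.
(* The two signs: of e^(i B) against e^(i A), and of sin(pi b) against sin(pi a). *)
pose e : R := cos (k%:~R * pi); pose e' : R := cos ((k * n)%:~R * pi).
have BE : B = A - k%:~R * pi by rewrite -ABk; ring.
have cB : cos B = e * cos A by rewrite BE cosB sin_intpi mulr0 addr0 mulrC.
have sB : sin B = e * sin A by rewrite BE sinB sin_intpi mulr0 subr0 mulrC.
have sinc_e : sinc a + e * sinc b = 0.
  by apply: (half A); rewrite mulrDr mulrA [_ * e]mulrC -?cB -?sB.
have e0 : e != 0 := cos_intpi_neq0 k.
have sb : sinc b != 0.
  by apply: contra_neq sa => sb; move: sinc_e; rewrite sb mulr0 addr0.
(* If a or b is 0 the other one is an integer, where sinc is 0 or the sum is 2. *)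
have inte (z : int) : z%:~R = 0 :> R \/ sinc z%:~R = 0.
  by have [->|z0] := eqVneq z 0; [left|right; exact: sinc_int].
have a0 : a != 0.
  apply/eqP => a0; move: abk; rewrite a0 sub0r -intrM => /eqP; rewrite eqr_oppLR -mulrNz => /eqP bE.
  case: (inte (- (k * n))); rewrite -bE => b0; last by rewrite b0 eqxx in sb.
  move: hc; rewrite /A /B a0 b0 mulr0 mul0r cos0 /sinc eqxx => /eqP.
  by rewrite mulr1 -[1 + 1]/(2%:R) pnatr_eq0.
have b0 : b != 0.
  apply/eqP => b0; move: abk; rewrite b0 subr0 -intrM => aE.
  case: (inte (k * n)); rewrite -aE => a0'; last by rewrite a0' eqxx in sa.
  by rewrite a0' eqxx in a0.
have sinb : sin (pi * b) = e' * sin (pi * a).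
  have -> : pi * b = pi * a - (k * n)%:~R * pi by rewrite intrM -abk; ring.
  by rewrite sinB /e' sin_intpi mulr0 subr0 mulrC.
have sina0 : sin (pi * a) != 0.
  by apply: contra_neq sa => s0; rewrite /sinc (negbTE a0) s0 mul0r.
have bE : b = - (e * e') * a.
  move: sinc_e; rewrite /sinc (negbTE a0) (negbTE b0) sinb => h.
  have : (b + e * e' * a) * (sin (pi * a) / (pi * a * b)) = 0.
    rewrite -[RHS]h; move: (@pi R) pi0 => P P0; field.
    by rewrite a0 b0 P0.
  move/eqP; rewrite mulf_eq0 => /orP[/eqP h'|].
    by apply/eqP; rewrite mulNr -addr_eq0; apply/eqP.
  by rewrite mulf_eq0 (negbTE sina0) invr_eq0 !mulf_eq0 (negbTE pi0) (negbTE a0) (negbTE b0).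
have ee : (e * e') ^+ 2 = 1 by rewrite exprMn !cos_intpi_sqr mulr1.
have ba : b = - a.
  have /eqP : (e * e' - 1) * (e * e' + 1) = 0.
    by rewrite -subr_sqr ee expr1n subrr.
  rewrite mulf_eq0 subr_eq0 addr_eq0 => /orP[/eqP ee1|/eqP ee1]; first by rewrite bE ee1 mulN1r.
  have ba : b = a by rewrite bE ee1 opprK mul1r.
  have k0 : k = 0.
    apply/eqP; rewrite -(intr_eq0 R); move/eqP: abk; rewrite ba subrr eq_sym mulf_eq0.
    by rewrite (negbTE nz) orbF.
  have e1 : e = 1 by rewrite /e k0 mulr0z mul0r cos0.
  have e'1 : e' = 1 by rewrite /e' k0 (mul0r n) mulr0z mul0r cos0.
  move: ee1; rewrite e1 e'1 mulr1 => /eqP.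
  by rewrite -addr_eq0 -[1 + 1]/(2%:R) pnatr_eq0.
exists k; split => //.
by rewrite -abk ba opprK; lra.
Qed.

End transform.

(** * A function orthogonal to a total family vanishes *)

Section orthogonal_complement.
Context d (T : measurableType d) (R : realType) (P : probability T R).
Implicit Types f g u v : T -> R[i].

Definition cbounded_measurable f :=
  bounded_measurable (fun x => complex.Re (f x)) /\
  bounded_measurable (fun x => complex.Im (f x)).

Lemma cbmM f g : cbounded_measurable f -> cbounded_measurable g ->
  cbounded_measurable (fun x => f x * g x).
Proof.
move=> [rf jf] [rg jg]; split.
- have -> : (fun x => complex.Re (f x * g x)) =
    ((fun x => complex.Re (f x)) \* (fun x => complex.Re (g x))) \-
    ((fun x => complex.Im (f x)) \* (fun x => complex.Im (g x))).
    by apply/funext => x /=; case: (f x) => ? ?; case: (g x).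
  by apply: bmB; exact: bmM.
- have -> : (fun x => complex.Im (f x * g x)) =
    ((fun x => complex.Re (f x)) \* (fun x => complex.Im (g x))) \+
    ((fun x => complex.Im (f x)) \* (fun x => complex.Re (g x))).
    by apply/funext => x /=; case: (f x) => ? ?; case: (g x).
  by apply: bmD; exact: bmM.
Qed.

Lemma cbmD f g : cbounded_measurable f -> cbounded_measurable g ->
  cbounded_measurable (fun x => f x + g x).
Proof.
move=> [rf jf] [rg jg]; split.
- have -> : (fun x => complex.Re (f x + g x)) =
    ((fun x => complex.Re (f x)) \+ (fun x => complex.Re (g x))).
    by apply/funext => x /=; case: (f x) => ? ?; case: (g x).
  exact: bmD.
- have -> : (fun x => complex.Im (f x + g x)) =
    ((fun x => complex.Im (f x)) \+ (fun x => complex.Im (g x))).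
    by apply/funext => x /=; case: (f x) => ? ?; case: (g x).
  exact: bmD.
Qed.

Lemma cbm_cst (c : R[i]) : cbounded_measurable (fun=> c).
Proof. by split; exact: bm_cst. Qed.

Lemma cbm_conj f : cbounded_measurable f ->
  cbounded_measurable (fun x => conjc (f x)).
Proof.
move=> [rf jf]; split.
- have -> : (fun x => complex.Re (conjc (f x))) = (fun x => complex.Re (f x)).
    by apply/funext => x /=; case: (f x).
  by [].
- have -> : (fun x => complex.Im (conjc (f x))) = \- (fun x => complex.Im (f x)).
    by apply/funext => x /=; case: (f x).
  exact: bmN.
Qed.

Lemma bm_sqmodulus f : cbounded_measurable f -> bounded_measurable (fun x => sqmodulus (f x)).
Proof.
move=> [rf jf].
have -> : (fun x => sqmodulus (f x)) =
    ((fun x => complex.Re (f x)) \* (fun x => complex.Re (f x))) \+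
    ((fun x => complex.Im (f x)) \* (fun x => complex.Im (f x))).
  by apply/funext.
by apply: bmD; exact: bmM.
Qed.

Lemma cbm_L2 f : cbounded_measurable f -> L2 P f.
Proof.
move=> bf; split; first exact: bf.1.1; split; first exact: bf.2.1.
by apply/L2norm_lty; rewrite (bm_integral P (bm_sqmodulus bf)) ltry.
Qed.

Let cintegralD f g : cbounded_measurable f -> cbounded_measurable g ->
  cintegral P (fun x => f x + g x) = cintegral P f + cintegral P g.
Proof.
move=> [rf jf] [rg jg]; rewrite /cintegral.
have -> : (fun x => complex.Re (f x + g x)) =
    (fun x => complex.Re (f x) + complex.Re (g x)).
  by apply/funext => x /=; case: (f x) => ? ?; case: (g x).
have -> : (fun x => complex.Im (f x + g x)) =
    (fun x => complex.Im (f x) + complex.Im (g x)).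
  by apply/funext => x /=; case: (f x) => ? ?; case: (g x).
by rewrite !RintegralD//; exact: bm_integrable.
Qed.

Let cintegralZ (c : R[i]) f : cbounded_measurable f ->
  cintegral P (fun x => c * f x) = c * cintegral P f.
Proof.
move=> [rf jf]; rewrite /cintegral; case: c => a b.
have Zbm (k : R) (g : T -> R) : bounded_measurable g ->
    P.-integrable setT (EFin \o (fun x => k * g x)).
  by move=> bg; apply: bm_integrable; exact: (bmM (bm_cst _ k) bg).
have -> : (fun x => complex.Re (Complex a b * f x)) =
    (fun x => a * complex.Re (f x) + (- b) * complex.Im (f x)).
  by apply/funext => x /=; case: (f x) => ? ?; rewrite /= mulNr.
have -> : (fun x => complex.Im (Complex a b * f x)) =
    (fun x => a * complex.Im (f x) + b * complex.Re (f x)).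
  by apply/funext => x /=; case: (f x).
rewrite !RintegralD//; try exact: Zbm.
by rewrite !RintegralZl//; [|exact: bm_integrable..]; rewrite mulNr.
Qed.

(** By Pythagoras every combination S of members of B satisfies
   |g - S|^2 = |g|^2 + |S|^2 >= |g|^2, so S cannot come closer to g than 0 does. *)
Lemma dense_span_orthogonal (B : set (T -> R[i])) g :
  (forall u, B u -> cbounded_measurable u) -> cbounded_measurable g ->
  (forall u, B u -> L2dot P g u = 0) -> dense_span P B ->
  Rintegral P setT (fun x => sqmodulus (g x)) = 0.
Proof.
move=> bB bg gB dB; set r := Rintegral _ _ _.
have r0 : 0 <= r by apply: Rintegral_ge0 => x _; exact: sqmodulus_ge0.
apply/eqP; apply: contraT; rewrite neq_lt ltNge r0 /= => rp.
have sr : 0 < Num.sqrt r by rewrite sqrtr_gt0.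
have [n [c [u [Bu /(L2norm_lt _ _ sr)]]]] := dB g (cbm_L2 bg) _ sr.
rewrite sqr_sqrtr//; pose S x := \sum_(i < n) c i * u i x.
suff [bS gS] : cbounded_measurable S /\ L2dot P g S = 0.
  have bgS : cbounded_measurable (fun x => g x * conjc (S x)).
    by apply: cbmM => //; exact: cbm_conj.
  have E x : sqmodulus (g x - S x) =
      (sqmodulus (g x) + sqmodulus (S x)) + (-2) * complex.Re (g x * conjc (S x)).
    by rewrite /sqmodulus; case: (g x) => a b; case: (S x) => a' b' /=; ring.
  have -> : (\int[P]_x (sqmodulus (g x - S x)%R)%:E =
      (r + Rintegral P setT (fun x => sqmodulus (S x)))%:E)%E.
    under eq_integral do rewrite E.
    rewrite (bm_integral P (bmD (bmD (bm_sqmodulus bg) (bm_sqmodulus bS)) (bmM (bm_cst _ (-2)) bgS.1))).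
    rewrite RintegralD//=; last 2 first.
    - exact/bm_integrable/(bmD (bm_sqmodulus bg) (bm_sqmodulus bS)).
    - exact/bm_integrable/(bmM (bm_cst _ (-2)) bgS.1).
    rewrite RintegralD//=; last 2 first.
    - exact/bm_integrable/bm_sqmodulus.
    - exact/bm_integrable/bm_sqmodulus.
    rewrite RintegralZl//; last exact: (bm_integrable P bgS.1).
    have -> : Rintegral P setT (fun x => complex.Re (g x * conjc (S x))) = 0.
      by have /(congr1 (@complex.Re R)) := gS.
    by rewrite mulr0 addr0.
  rewrite lte_fin gtrDl ltNge Rintegral_ge0// => x _; exact: sqmodulus_ge0.
rewrite /S => {S}; elim: n c u Bu => [|n IH] c u Bu.
  have -> : (fun x => \sum_(i < 0) c i * u i x) = (fun=> 0).
    by apply/funext => x; rewrite big_ord0.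
  split; first exact: cbm_cst.
  rewrite /L2dot (_ : (fun x => _) = (fun x => 0 * g x)).
    by rewrite cintegralZ ?mul0r.
  by apply/funext => x; rewrite conjc0 mulr0 mul0r.
have -> : (fun x => \sum_(i < n.+1) c i * u i x) =
    (fun x => c ord0 * u ord0 x +
      \sum_(i < n) (c \o lift ord0) i * (u \o lift ord0) i x).
  by apply/funext => x; rewrite big_ord_recl.
have [bS gS] := IH (c \o lift ord0) (u \o lift ord0) (fun i => Bu _).
have bu : cbounded_measurable (fun x => c ord0 * u ord0 x).
  by apply: cbmM; [exact: cbm_cst|exact/bB].
split; first exact: cbmD bu bS.
rewrite /L2dot (_ : (fun x => _) = (fun x =>
    (conjc (c ord0) * (g x * conjc (u ord0 x))) +
    g x * conjc (\sum_(i < n) (c \o lift ord0) i * (u \o lift ord0) i x))).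
  have bgu : cbounded_measurable (fun x => g x * conjc (u ord0 x)).
    by apply: cbmM => //; apply: cbm_conj; exact: bB.
  rewrite cintegralD; last 2 first.
  - by apply: cbmM => //; exact: cbm_cst.
  - by apply: cbmM => //; exact: cbm_conj.
  rewrite cintegralZ//.
  have := gB _ (Bu ord0); rewrite /L2dot => ->.
  by rewrite mulr0 add0r; exact: gS.
by apply/funext => x; rewrite rmorphD rmorphM mulrDr mulrCA.
Qed.

End orthogonal_complement.

(** * Exponentials modulated by a function on each leg *)

Section modulated.
Context {R : realType} (t : R).
Local Notation leb := (@lebesgue_measure R).
Local Notation RI f := (Rintegral leb `[t, t + 1] f).

Lemma cbm_expo (l : R * R) : cbounded_measurable (@expo R l).
Proof. by split; [exact: bm_expoRe|exact: bm_expoIm]. Qed.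

Lemma sqmodulus_expo (l : R * R) p : sqmodulus (expo l p) = 1.
Proof. by rewrite /sqmodulus /expo /= cos2Dsin2. Qed.

Lemma spectrum_total (L : set (R * R)) g :
  cbounded_measurable g -> dense_span (rho t) (exps L) ->
  (forall l, L l -> L2dot (rho t) g (expo l) = 0) ->
  Rintegral (rho t) setT (fun x => sqmodulus (g x)) = 0.
Proof.
move=> bg dL gL; apply: dense_span_orthogonal dL => //.
- by move=> _ [l _ <-]; exact: cbm_expo.
- by move=> _ [l Ll <-]; exact: gL.
Qed.

Lemma dense_exps_not_orthogonal (L : set (R * R)) m :
  dense_span (rho t) (exps L) ->
  (forall l, L l -> L2dot (rho t) (expo m) (expo l) = 0) -> False.
Proof.
move=> dL mL; have := spectrum_total (cbm_expo m) dL mL.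
under eq_Rintegral do rewrite sqmodulus_expo.
rewrite Rintegral_cst// mul1r (_ : fine _ = 1); first by move/eqP; rewrite oner_eq0.
exact: (f_equal fine (rho_setT t)).
Qed.

Variables u v : measurableTypeR R -> R.
Hypotheses (bu : bounded_measurable u) (bv : bounded_measurable v).
Hypotheses (u0 : u 0 = 0) (v0 : v 0 = 0).

(** As u and v vanish at 0, this is u e_l on the horizontal axis and v e_l on the
   vertical one, with no exception at the origin. *)
Definition modulated (l : R * R) (p : plane R) : R[i] :=
  (u p.1 + v p.2)%:C%C * expo l p.

Let bG : bounded_measurable (fun p : plane R => u p.1 + v p.2).
Proof.
by apply: bmD; exact: bm_comp.
Qed.

Lemma cbm_modulated l : cbounded_measurable (modulated l).
Proof. by apply: cbmM; [split => //; exact: bm_cst|exact: cbm_expo]. Qed.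

Lemma L2dot_modulated l l' : L2dot (rho t) (modulated l) (expo l') =
  let a := l.1 - l'.1 in let b := l.2 - l'.2 in
  Complex (2^-1 * (RI (fun x => u x * cos (2 * pi * a * x)) +
                   RI (fun y => v y * cos (2 * pi * b * y))))
          (2^-1 * (RI (fun x => u x * sin (2 * pi * a * x)) +
                   RI (fun y => v y * sin (2 * pi * b * y)))).
Proof.
have -> : L2dot (rho t) (modulated l) (expo l') =
    cintegral (rho t) (fun p => (u p.1 + v p.2)%:C%C * expo (l - l') p).
  congr cintegral; apply/funext => p.
  by rewrite /modulated -mulrA expo_mul_conj.
have ReE : (fun p : plane R => complex.Re ((u p.1 + v p.2)%:C%C * expo (l - l') p)) =
    (fun p => (u p.1 + v p.2)) \* (fun p => complex.Re (expo (l - l') p)).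
  by apply/funext => p /=; rewrite mul0r subr0.
have ImE : (fun p : plane R => complex.Im ((u p.1 + v p.2)%:C%C * expo (l - l') p)) =
    (fun p => (u p.1 + v p.2)) \* (fun p => complex.Im (expo (l - l') p)).
  by apply/funext => p /=; rewrite mul0r addr0.
rewrite /cintegral ReE ImE !Rintegral_rho; last 2 first.
- by apply: bmM => //; exact: bm_expoIm.
- by apply: bmM => //; exact: bm_expoRe.
by congr (Complex (_ * (_ + _)) (_ * (_ + _))); apply: eq_Rintegral => x _ /=;
  rewrite ?u0 ?v0 mulr0 ?addr0 ?add0r !mulrA.
Qed.

Lemma Rintegral_sqmodulus_modulated l :
  Rintegral (rho t) setT (fun p => sqmodulus (modulated l p)) =
  2^-1 * (RI (fun x => u x ^+ 2) + RI (fun y => v y ^+ 2)).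
Proof.
have E : (fun p => sqmodulus (modulated l p)) = (fun p => (u p.1 + v p.2) ^+ 2).
  apply/funext => p; rewrite -[RHS]mulr1 -(sqmodulus_expo l p) /modulated /sqmodulus.
  by case: (expo l p) => a b /=; ring.
rewrite E Rintegral_rho; last first.
  have -> : (fun p : plane R => (u p.1 + v p.2) ^+ 2) =
    (fun p => u p.1 + v p.2) \* (fun p => u p.1 + v p.2) by [].
  exact: bmM.
by congr (_ * (_ + _)); apply: eq_Rintegral => x _ /=; rewrite ?u0 ?v0 ?addr0 ?add0r.
Qed.

End modulated.

(** * Location of the points of a spectrum *)

Section spectra.
Context {R : realType} (t : R).
Local Notation leb := (@lebesgue_measure R).
Local Notation RI f := (Rintegral leb `[t, t + 1] f).
Implicit Types (L : set (R * R)) (l : R * R) (n : int).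

(** The last clause covers two cases: for distinct orthogonal points both
   coordinates of the difference are nonzero, for equal points both are zero. *)
Definition integral_differences l l' := exists j k : int,
  [/\ l.1 - l'.1 = j%:~R, l.2 - l'.2 = k%:~R & (j == 0) = (k == 0)].

Definition antidiagonal_differences n l l' := exists k : int,
  l.1 - l'.1 = k%:~R * n%:~R / 2 /\ l.2 - l'.2 = - (k%:~R * n%:~R / 2).

Lemma orthogonal_differences L n l l' : 0 < n -> 2 * t + 1 = 1 / n%:~R ->
  Defs.orthonormal (rho t) (exps L) -> L l -> L l' ->
  integral_differences l l' \/ antidiagonal_differences n l l'.
Proof.
move=> n0 tn oL Ll Ll'; have [<-|ll'] := pselect (l = l').
  by left; exists 0, 0; rewrite !subrr.
have := oL (expo l) (expo l') (imageP _ Ll) (imageP _ Ll').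
rewrite L2dot_expo /= tn (_ : `[< _ >] = false); last first.
  by apply/asboolPn => /expo_inj.
move=> [/eqP + /eqP].
have h2 (x : R) : (2^-1 * x == 0) = (x == 0) by rewrite mulf_eq0 invr_eq0 pnatr_eq0.
rewrite !h2 => /eqP hc /eqP hs.
have [[j [k [j0 k0 aj bk]]]|[k [ak bk]]] := transform_zero n0 hc hs.
  by left; exists j, k; rewrite (negbTE j0) (negbTE k0).
by right; exists k; rewrite bk ak.
Qed.

Let bm_RI_cos (a : R) : bounded_measurable
  (fun x : measurableTypeR R => cos (2 * pi * a * x)).
Proof. by apply: bm_cos; exact: measurable_funM. Qed.

Let bm_RI_sin (a : R) : bounded_measurable
  (fun x : measurableTypeR R => sin (2 * pi * a * x)).
Proof. by apply: bm_sin; exact: measurable_funM. Qed.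

Lemma bm_integrable_itv (a b : R) (f : measurableTypeR R -> R) :
  bounded_measurable f -> leb.-integrable `[a, b] (EFin \o f).
Proof.
move=> [mf [M fM]]; apply: measurable_bounded_integrable.
- exact: measurable_itv.
- have : (leb `[a, b]%classic < +oo)%E.
    by rewrite lebesgue_measure_itv/=; case: ifP => _; rewrite ltry.
  by [].
- exact: measurable_funTS.
- exists M; split; [exact: num_real|move=> x Mx y _].
  exact: le_trans (fM y) (ltW Mx).
Qed.

Let RIN (f : measurableTypeR R -> R) : bounded_measurable f ->
  RI (fun x => - f x) = - RI f.
Proof.
move=> bf; rewrite -mulN1r -RintegralZl//; last exact: bm_integrable_itv.
by apply: eq_Rintegral => x _; rewrite mulN1r.
Qed.

(** The constant 1, changed at 0 as [modulated] requires. *)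
Let u0 (x : measurableTypeR R) : R := \1_(~` [set (0 : measurableTypeR R)]) x.

Let RI_u0 (f : measurableTypeR R -> R) : bounded_measurable f ->
  RI (fun x => u0 x * f x) = RI f.
Proof.
move=> [mf _]; have m0 : measurable [set (0 : measurableTypeR R)] by exact: measurable_set1.
have mD : measurable (`[t, t + 1]%classic `\ (0 : measurableTypeR R)).
  by apply: measurableD => //; exact: measurable_itv.
have E (g : measurableTypeR R -> R) : measurable_fun setT g ->
   RI g = Rintegral leb (`[t, t + 1] `\ 0) g.
  move=> mg; rewrite /Rintegral integral_setD1//.
  by apply/measurable_EFinP; exact: measurable_funTS.
rewrite E; last first.
  by apply: measurable_funM => //; apply: measurable_indic; exact: measurableC.
rewrite [RHS]E//; apply: eq_Rintegral => x; rewrite inE /= => -[_ x0].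
by rewrite /u0 indicE mem_set ?mul1r.
Qed.

(** The function e_l0 on the horizontal leg, - e_l0 on the vertical one: its
   inner product with e_l is (m(a) - m(b)) / 2, and m is 1 at 0 and 0 at the
   other integers. *)
Lemma integral_differences_not_dense L l0 : dense_span (rho t) (exps L) ->
  ~ (forall l, L l -> integral_differences l0 l).
Proof.
move=> dL zL.
have m0 : measurable (~` [set (0 : measurableTypeR R)]).
  by apply: measurableC; exact: measurable_set1.
have bu : bounded_measurable u0 by exact: bm_indic.
have u00 : u0 0 = 0 by rewrite /u0 indicE memNset//= => /(_ erefl).
pose v0 := \- u0; have v00 : v0 0 = 0 by rewrite /v0 /= u00 oppr0.
have bv : bounded_measurable v0 by exact: bmN.
have RIv (f : measurableTypeR R -> R) : bounded_measurable f ->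
    RI (fun x => v0 x * f x) = - RI f.
  move=> bf; rewrite -(RI_u0 bf) -RIN; last exact: bmM bu bf.
  by apply: eq_Rintegral => x _; rewrite /v0 /= mulNr.
have := spectrum_total (cbm_modulated bu bv l0) dL.
rewrite Rintegral_sqmodulus_modulated// => H.
have : 2^-1 * (RI (fun x => u0 x ^+ 2) + RI (fun x => v0 x ^+ 2)) = 0.
  apply: H => l /zL[j [k [aj bk jk]]]; rewrite L2dot_modulated//= aj bk.
  rewrite !RIv ?RI_u0; do ?[exact: bm_RI_sin|exact: bm_RI_cos].
  rewrite !Rintegral_unit_cos !Rintegral_unit_sin.
  have [j0|j0] := eqVneq j 0.
    by move: jk; rewrite j0 eqxx => /esym/eqP ->; rewrite !subrr !mulr0.
  rewrite !sinc_int -?jk// !mulr0 !subrr !mulr0//.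
have E : RI (fun x => u0 x ^+ 2) = 1.
  have -> : RI (fun x => u0 x ^+ 2) = RI (fun x => u0 x * cst 1 x).
    apply: eq_Rintegral => x _; rewrite /u0 indicE mulr1.
    by case: (x \in _); rewrite ?expr1n ?expr0n.
  rewrite RI_u0; last exact: bm_cst.
  have := Rintegral_unit_cos t 0; rewrite [pi * 0]mulr0 mul0r cos0 mul1r /sinc eqxx => e; rewrite -[RHS]e.
  by apply: eq_Rintegral => x _; rewrite mulr0 mul0r cos0.
have E' : RI (fun x => v0 x ^+ 2) = 1.
  by rewrite -[RHS]E; apply: eq_Rintegral => x _; rewrite /v0 /= sqrrN.
by rewrite E E' => /eqP; rewrite mulf_eq0 invr_eq0 -[1 + 1]/(2%:R) !pnatr_eq0.
Qed.

Lemma spectrum_nonempty L : dense_span (rho t) (exps L) -> exists l, L l.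
Proof.
move=> dL; apply: contrapT => nL.
apply: (dense_exps_not_orthogonal (m := 0) dL) => l Ll.
by exfalso; apply: nL; exists l.
Qed.

(** A point l1 whose difference with l0 is not integral is at an antidiagonal
   difference from it. Any other point differs from l0 or from l1 by a
   nonintegral, hence antidiagonal, vector, and in both cases it lies on the
   antidiagonal lattice through l0. *)
Lemma spectrum_antidiagonal L n : 0 < n -> 2 * t + 1 = 1 / n%:~R ->
  spectrum (rho t) L ->
  exists2 l0, L l0 & forall l, L l -> antidiagonal_differences n l0 l.
Proof.
move=> n0 tn [_ [_ oL dL]].
have [l0 Ll0] := spectrum_nonempty dL; exists l0 => //.
have od l l' : L l -> L l' -> integral_differences l l' \/ antidiagonal_differences n l l'.
  exact: orthogonal_differences.
have [l1 Ll1 nz1] : exists2 l1, L l1 & ~ integral_differences l0 l1.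
  apply: contrapT => h; apply: (integral_differences_not_dense (l0 := l0) dL) => l Ll.
  by apply: contrapT => nz; apply: h; exists l.
have [//|[k1 [a1 b1]]] := od _ _ Ll0 Ll1.
move=> l Ll; have [z|//] := od _ _ Ll0 Ll.
have [z1|[k2 [a2 b2]]] := od _ _ Ll Ll1.
  exfalso; apply: nz1; have [j [k [aj bk _]]] := z; have [j1 [k1' [aj1 bk1 _]]] := z1.
  have aE : l0.1 - l1.1 = (j + j1)%:~R by rewrite intrD -aj -aj1; ring.
  have bE : l0.2 - l1.2 = (k + k1')%:~R by rewrite intrD -bk -bk1; ring.
  exists (j + j1), (k + k1'); split => //.
  rewrite -(intr_eq0 R) -[RHS](intr_eq0 R) -aE -bE b1 a1.
  by rewrite oppr_eq0.
exists (k1 - k2); rewrite intrD mulrNz; split.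
  rewrite (_ : l0.1 - l.1 = (l0.1 - l1.1) - (l.1 - l1.1)); last by ring.
  by rewrite a1 a2; ring.
rewrite (_ : l0.2 - l.2 = (l0.2 - l1.2) - (l.2 - l1.2)); last by ring.
by rewrite b1 b2; ring.
Qed.

(** The functions e_l / e_l0 depend on x - y only, so they take the same values
   on ]0, - t] in the horizontal leg and, mirrored, on [t, 0[ in the vertical
   leg; e_l0 times a function with opposite values on the two stretches is
   orthogonal to every e_l. *)
Lemma antidiagonal_not_dense L l0 : - 2^-1 < t -> t < 0 ->
  dense_span (rho t) (exps L) ->
  ~ (forall l, L l -> l0.2 - l.2 = - (l0.1 - l.1)).
Proof.
move=> t2 t0 dL zL.
pose h : measurableTypeR R -> R := \1_(`]0, - t]%classic : set (measurableTypeR R)).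
pose h' : measurableTypeR R -> R := \1_(`[t, 0[%classic : set (measurableTypeR R)).
have bh : bounded_measurable h by apply: bm_indic; exact: measurable_itv.
have bh' : bounded_measurable h' by apply: bm_indic; exact: measurable_itv.
have h0 : h 0 = 0 by rewrite /h indicE memNset//= in_itv/= ltxx.
have h'0 : (\- h') 0 = 0 by rewrite /= /h' indicE memNset ?oppr0//= in_itv/= ltxx andbF.
have indic_RI (E : set (measurableTypeR R)) (f : measurableTypeR R -> R) :
    E `<=` `[t, t + 1]%classic -> measurable E ->
    RI (fun x => \1_E x * f x) = Rintegral leb E f.
  move=> ED mE; rewrite -(setIidr ED) [RHS]Rintegral_mkcondr.
  apply: eq_Rintegral => x _; rewrite setIidr// indicE patchE.
  by case: (x \in E); rewrite ?mul1r ?mul0r.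
have RIh (f : measurableTypeR R -> R) : bounded_measurable f ->
    RI (fun x => h x * f x) = Rintegral leb `[0, - t] f.
  move=> bf; rewrite indic_RI//.
  - apply: Rintegral_itv_obnd_cbnd; apply: integrableS (bm_integrable_itv 0 (- t) bf) => //.
    by apply: subset_itvr; rewrite bnd_simp.
  - by move=> x /=; rewrite !in_itv/= => /andP[? ?]; apply/andP; split; lra.
have RIh' (f : measurableTypeR R -> R) : bounded_measurable f ->
    RI (fun x => h' x * f x) = Rintegral leb `[t, 0] f.
  move=> bf; rewrite indic_RI//.
  - apply: Rintegral_itv_bndo_bndc; apply: integrableS (bm_integrable_itv t 0 bf) => //.
    by apply: subset_itvl; rewrite bnd_simp.
  - by move=> x /=; rewrite !in_itv/= => /andP[? ?]; apply/andP; split; lra.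
have RINh' (f : measurableTypeR R -> R) : bounded_measurable f ->
    RI (fun x => (\- h') x * f x) = - Rintegral leb `[t, 0] f.
  move=> bf; rewrite -RIh'// -RIN; last exact: bmM bh' bf.
  by apply: eq_Rintegral => x _; rewrite /= mulNr.
have Nt : 0 < - t by lra.
have := spectrum_total (cbm_modulated bh (bmN bh') l0) dL.
rewrite Rintegral_sqmodulus_modulated//; last exact: bmN.
have RI1 (a b : R) : a <= b -> Rintegral leb `[a, b] (cst 1) = b - a.
  move=> ab; rewrite Rintegral_cst// mul1r.
  have e : leb `[a, b]%classic = (b - a)%:E.
    rewrite lebesgue_measure_itv/= lte_fin; case: ltP => // ba.
    by rewrite (_ : b = a) ?subrr//; apply/le_anti; rewrite ab ba.
  exact: (f_equal fine e).
move=> H; have : 2^-1 * (RI (fun x => h x ^+ 2) + RI (fun x => (\- h') x ^+ 2)) = 0.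
  apply: H => l /zL ll; rewrite L2dot_modulated//=; last exact: bmN.
  rewrite ll; set a := l0.1 - l.1.
  rewrite !RIh ?RINh'; do ?[exact: bm_RI_sin|exact: bm_RI_cos].
  have [->|a0] := eqVneq a 0.
    have c1 (b : R) : Rintegral leb `[b, b - t] (fun x => cos (0 * x)) = - t.
      have e : b - t - b = - t by ring.
      rewrite -[RHS]e -[RHS]RI1; last by rewrite lerDl ltW.
      by apply: eq_Rintegral => x _; rewrite mul0r cos0.
    have s0 (b c : R) : Rintegral leb `[b, c] (fun x => sin (0 * x)) = 0.
      rewrite -[RHS](mul0r (fine (leb `[b, c]%classic))) -Rintegral_cst//.
      by apply: eq_Rintegral => x _; rewrite mul0r sin0.
    rewrite oppr0 mulr0 !s0 subrr mulr0.
    have := c1 0; have := c1 t; rewrite subrr add0r => -> ->.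
    by rewrite subrr mulr0.
  have pi0 : pi != 0 :> R by rewrite gt_eqF// pi_gt0.
  have w0 : 2 * pi * a != 0 by rewrite !mulf_neq0.
  have w0' : 2 * pi * (- a) != 0 by rewrite mulrN oppr_eq0.
  rewrite !Rintegral_cos ?Rintegral_sin//.
  rewrite !mulr0 sin0 cos0 !mulrN !mulNr sinN cosN invrN.
  by congr (Complex _ _); ring.
have sq (E : set (measurableTypeR R)) : (fun x => \1_E x ^+ 2 : R) = (fun x => \1_E x * cst 1 x).
  apply/funext => x; rewrite indicE mulr1.
  by case: (x \in E); rewrite ?expr1n ?expr0n.
have -> : RI (fun x => (\- h') x ^+ 2) = RI (fun x => h' x ^+ 2).
  by apply: eq_Rintegral => x _ /=; rewrite sqrrN.
rewrite !sq RIh ?RIh' ?RI1; try exact: bm_cst; try lra.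
Qed.

Lemma not_spectral n : - 2^-1 < t -> 1 < n -> 2 * t + 1 = 1 / n%:~R ->
  ~ spectral (rho t).
Proof.
move=> t2 n1 tn [L sL].
have n0 : 0 < n by exact: lt_trans n1.
have [l0 Ll0 H] := spectrum_antidiagonal n0 tn sL.
(* n > 1 means that the interval has points on both sides of 0. *)
have t0 : t < 0.
  have : 2 * t + 1 < 1.
    rewrite tn div1r invf_lt1 ?ltr0z//.
    by rewrite -[1]/(1%:~R) ltr_int.
  lra.
apply: (@antidiagonal_not_dense L l0) => //; first by case: sL => _ [].
by move=> l /H[k [-> ->]].
Qed.

End spectra.

(** * Uniqueness for t = 0 *)

Section uniqueness.
Context {R : realType}.

Lemma antidiagonal_orthogonal (k : int) (l l' : R * R) : k != 0 ->
  l.1 - l'.1 = k%:~R / 2 -> l.2 - l'.2 = - (k%:~R / 2) ->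
  L2dot (rho (0 : R)) (expo l) (expo l') = 0.
Proof.
move=> k0 h1 h2; rewrite L2dot_expo /= h1 h2 mulr0 add0r !mulr1 sincN.
rewrite mulrN cosN sinN mulNr subrr mulr0.
have kr : k%:~R / 2 != 0 :> R by rewrite mulf_neq0 ?intr_eq0// invr_eq0.
rewrite /sinc (negbTE kr).
set x : R := pi * (k%:~R / 2).
have x0 : sin x * cos x = 0.
  have : sin (x + x) = 0.
    by have -> : x + x = k%:~R * pi; [rewrite /x; move: (@pi R) => P; field|exact: sin_intpi].
  rewrite sinD [cos x * _]mulrC -mulr2n => /eqP.
  by rewrite mulrn_eq0 => /eqP.
have -> : cos x * (sin x / x) = 0 by rewrite mulrA [cos x * _]mulrC x0 mul0r.
by rewrite addr0 mulr0.
Qed.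

(** The antidiagonal lattice is itself orthogonal, so a point of it missing from
   L would give an exponential orthogonal to the total family of L. *)
Lemma spectrum0_shape (L : set (R * R)) : spectrum (rho (0 : R)) L ->
  exists l0, forall l, L l <-> exists k : int,
    l0.1 - l.1 = k%:~R / 2 /\ l0.2 - l.2 = - (k%:~R / 2).
Proof.
move=> sL; have t1 : 2 * 0 + 1 = 1 / 1%:~R :> R by rewrite mulr0 add0r divr1.
have [l0 Ll0 H] := spectrum_antidiagonal ltr01 t1 sL.
exists l0 => l; split.
  by move=> /H[k]; rewrite mulr1 => -[h1 h2]; exists k.
move=> [k [h1 h2]]; apply: contrapT => nLl.
have dL : dense_span (rho (0 : R)) (exps L) by case: sL => _ [].
apply: (dense_exps_not_orthogonal (m := l) dL) => l' Ll'.
have [k' [h1' h2']] := H _ Ll'; rewrite mulr1 in h1' h2'.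
have [kk|kk] := eqVneq k k'.
  exfalso; apply: nLl; rewrite (_ : l = l')//; rewrite kk in h1 h2.
  rewrite [l]surjective_pairing [l']surjective_pairing.
  by congr pair; [apply: oppr_inj; apply: (addrI l0.1)|apply: oppr_inj; apply: (addrI l0.2)];
    rewrite ?h1 ?h2.
apply: (@antidiagonal_orthogonal (k' - k)); first by rewrite subr_eq0 eq_sym.
- move: h1 h1'; rewrite intrD mulrNz; lra.
- move: h2 h2'; rewrite intrD mulrNz; lra.
Qed.

Lemma spectrum0_unique (L L' : set (R * R)) :
  spectrum (rho (0 : R)) L -> spectrum (rho (0 : R)) L' ->
  exists v : R * R, L' = [set l + v | l in L].
Proof.
move=> /spectrum0_shape[l0 H] /spectrum0_shape[l0' H'].
exists (l0' - l0); apply/seteqP; split => [l /H'[k [h1 h2]]|_ [l /H[k [h1 h2]] <-]].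
  exists (l - (l0' - l0)); last by rewrite subrK.
  by apply/H; exists k; split; [rewrite -h1|rewrite -h2] => /=; ring.
by apply/H'; exists k; split; [rewrite -h1|rewrite -h2] => /=; ring.
Qed.

End uniqueness.

(** * Existence for t = 0 *)

Section existence.
Context {R : realType}.
Local Notation leb := (@lebesgue_measure R).
Local Notation rho0 := (rho (0 : R)).

Definition half_freq (k : int) : R * R := (k%:~R / 2, - (k%:~R / 2)).

Lemma half_freqD j k : half_freq (j + k) = half_freq j + half_freq k.
Proof. by congr pair; rewrite intrD mulrDl ?opprD. Qed.

Lemma expoD (l l' : R * R) p : expo l p * expo l' p = expo (l + l') p.
Proof.
rewrite /expo /=; set u := 2 * pi * (l.1 * _ + _); set v := 2 * pi * (l'.1 * _ + _).
have -> : 2 * pi * ((l.1 + l'.1) * p.1 + (l.2 + l'.2) * p.2) = u + v.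
  by rewrite /u /v; ring.
rewrite cosD sinD; apply/eqP; rewrite eq_complex /=.
by apply/andP; split; apply/eqP; ring.
Qed.

Lemma expo0 p : expo (0 : R * R) p = 1.
Proof. by rewrite /expo /= !mul0r addr0 mulr0 cos0 sin0. Qed.

Definition trig_sum (s : seq (R[i] * int)) (p : plane R) : R[i] :=
  \sum_(x <- s) x.1 * expo (half_freq x.2) p.

Definition trig (f : plane R -> R[i]) := exists s, f =1 trig_sum s.

Lemma trigD f g : trig f -> trig g -> trig (fun p => f p + g p).
Proof.
move=> [s fs] [s' gs']; exists (s ++ s') => p.
by rewrite fs gs' /trig_sum big_cat.
Qed.

Lemma trigM f g : trig f -> trig g -> trig (fun p => f p * g p).
Proof.
move=> [s fs] [s' gs'].
exists [seq (x.1 * y.1, x.2 + y.2) | x <- s, y <- s'] => p.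
rewrite fs gs' /trig_sum big_allpairs_dep mulr_suml; apply: eq_bigr => x _.
rewrite mulr_sumr; apply: eq_bigr => y _ /=.
by rewrite half_freqD -expoD mulrACA.
Qed.

Lemma trigZ_expo (c : R[i]) k : trig (fun p => c * expo (half_freq k) p).
Proof. by exists [:: (c, k)] => p; rewrite /trig_sum big_seq1. Qed.

Lemma trig_cst (c : R[i]) : trig (fun=> c).
Proof.
exists [:: (c, 0)] => p; rewrite /trig_sum big_seq1 /= /half_freq.
by rewrite mul0r oppr0 (expo0 p) mulr1.
Qed.

Lemma trig_cbm f : trig f -> cbounded_measurable f.
Proof.
move=> [s fs]; have -> : f = trig_sum s by exact/funext.
rewrite /trig_sum; elim: s {f fs} => [|x s IH].
  by under eq_fun do rewrite big_nil; exact: cbm_cst.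
under eq_fun do rewrite big_cons.
by apply: cbmD IH; apply: cbmM; [exact: cbm_cst|exact: cbm_expo].
Qed.

Definition real_trig : set (plane R -> R) :=
  [set q | trig (fun p => (q p)%:C%C)].

Lemma real_trig_algebra : bounded_algebra real_trig.
Proof.
split.
- by move=> q /trig_cbm[].
- by move=> c; exact: (trig_cst (c%:C)%C).
- move=> p q tp tq; have [s h] := trigD tp tq; exists s => x.
  by rewrite -h /= rmorphD.
- move=> p q tp tq; have [s h] := trigM tp tq; exists s => x.
  by rewrite -h /= rmorphM.
Qed.

Lemma real_trig_cos : real_trig (fun p => cos (pi * (p.1 - p.2))).
Proof.
have [s h] := trigD (trigZ_expo (2^-1)%:C%C 1) (trigZ_expo (2^-1)%:C%C (- 1)).
exists s => p; rewrite -h /expo /half_freq /=.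
have -> : 2 * pi * (1%:~R / 2 * p.1 + - (1%:~R / 2) * p.2) = pi * (p.1 - p.2).
  by move: (@pi R) => P; field.
have -> : 2 * pi * ((- 1)%:~R / 2 * p.1 + - ((- 1)%:~R / 2) * p.2) = - (pi * (p.1 - p.2)).
  by rewrite mulrNz; move: (@pi R) => P; field.
rewrite cosN sinN; apply/eqP; rewrite eq_complex /=.
by apply/andP; split; apply/eqP; field.
Qed.

Lemma real_trig_sin : real_trig (fun p => sin (pi * (p.1 - p.2))).
Proof.
have [s h] := trigD (trigZ_expo (Complex 0 (- 2^-1)) 1) (trigZ_expo (Complex 0 2^-1) (- 1)).
exists s => p; rewrite -h /expo /half_freq /=.
have -> : 2 * pi * (1%:~R / 2 * p.1 + - (1%:~R / 2) * p.2) = pi * (p.1 - p.2).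
  by move: (@pi R) => P; field.
have -> : 2 * pi * ((- 1)%:~R / 2 * p.1 + - ((- 1)%:~R / 2) * p.2) = - (pi * (p.1 - p.2)).
  by rewrite mulrNz; move: (@pi R) => P; field.
rewrite cosN sinN; apply/eqP; rewrite eq_complex /=.
by apply/andP; split; apply/eqP; field.
Qed.

(** The support of rho for t = 0 without its three points where
   sin(pi (x - y)) vanishes. *)
Definition open_legs : set (plane R) :=
  [set p | (0 < p.1 < 1 /\ p.2 = 0) \/ (p.1 = 0 /\ 0 < p.2 < 1)].

Lemma measurable_open_legs : measurable open_legs.
Proof.
have -> : open_legs = ((`]0, 1[%classic : set (measurableTypeR R)) `*` [set 0]) `|`
    ([set (0 : measurableTypeR R)] `*` `]0, 1[%classic).
  by apply/seteqP; split => -[x y] /=; rewrite !in_itv.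
by apply: measurableU; apply: measurableX; [exact: measurable_itv|
  exact: measurable_set1|exact: measurable_set1|exact: measurable_itv].
Qed.

Lemma ae_open_legs : {ae rho0, forall p, open_legs p}.
Proof.
have mC := measurableC measurable_open_legs.
exists (~` open_legs); split => //.
have I0 (f : measurableTypeR R -> \bar R) : measurable_fun setT f ->
    (forall x, 0 < x < 1 -> f x = 0%E) -> (\int[lebI 0]_x f x = 0)%E.
  move=> mf f0; rewrite integral_lebI// add0r.
  rewrite -integral_itv_obnd_cbnd; last exact: measurable_funTS.
  rewrite -integral_itv_bndo_bndc; last exact: measurable_funTS.
  by apply: integral0_eq => x /=; rewrite in_itv; exact: f0.
have mF : measurable_fun setT (fun p : plane R => (\1_(~` open_legs) p : R)%:E).
  by apply/measurable_EFinP; exact: measurable_indic.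
have := @ge0_integral_rho R 0 (fun p => (\1_(~` open_legs) p)%:E) mF.
rewrite integral_indic// setIT => -> //.
rewrite !I0 ?adde0 ?mule0//.
- exact: (measurableT_comp mF measurable_axis2).
- by move=> x x01; rewrite indicE memNset//=; apply; right.
- exact: (measurableT_comp mF measurable_axis1).
- by move=> x x01; rewrite indicE memNset//=; apply; left.
Qed.

Let S := approximable_set rho0 real_trig.

(** On one leg pr is a coordinate ranging over (0, 1), where cos(pi pr) is
   decreasing, and on the other leg it is 0; the sign of sg tells the legs
   apart. So for 0 <= c < 1 the set is, up to a null set, given by the two
   inequalities sg > 0 and cos(pi (x - y)) < cos(pi c). *)
Let approximable_ray (pr sg : plane R -> R) (c : R) :
  measurable_fun setT pr -> real_trig sg ->
  (forall p, open_legs p ->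
    (0 < pr p < 1 /\ 0 < sg p /\ cos (pi * (p.1 - p.2)) = cos (pi * pr p)) \/
    (pr p = 0 /\ sg p < 0)) ->
  S [set p | c < pr p].
Proof.
move=> mpr tsg H.
have algA := real_trig_algebra.
have mS : measurable [set p | c < pr p].
  have -> : [set p | c < pr p] = setT `&` pr @^-1` `]c, +oo[.
    by rewrite setTI; apply/funext => x /=; rewrite in_itv/= andbT.
  by apply: mpr => //; exact: measurable_itv.
have S0 : approximable_set rho0 real_trig set0 by exact: approximable_set0.
have [c0|c0] := ltP c 0.
  apply: (approximable_set_ae algA (approximable_setC algA S0)) => //.
  apply: filterS ae_open_legs => p /H h.
  have cp : c < pr p by case: h => [[/andP[? _] _]|[-> _]] //; lra.
  by split => // _ [].
have [c1|c1] := leP 1 c.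
  apply: (approximable_set_ae algA S0) => //.
  apply: filterS ae_open_legs => p /H h; split => //= cp.
  by case: h => [[/andP[_ ?] _]|[? _]]; lra.
have tN : real_trig (cst (-1) \* sg).
  by apply: (bounded_algebraM algA) => //; exact: bounded_algebra_cst.
have S1 := approximable_ltr rho0 algA 0 tN.
have S2 := approximable_ltr rho0 algA (cos (pi * c)) real_trig_cos.
apply: (approximable_set_ae algA (approximable_setI algA S1 S2)) => //.
apply: filterS ae_open_legs => p /H h /=.
case: h => [[/andP[p0 p1] [s0 ->]]|[-> s0]]; last first.
  by split => [[]|]; lra.
have pi0 := pi_gt0 R.
rewrite ltr_cos ?in_itv/=; last 2 first.
- by rewrite mulr_ge0 ?(ltW pi0)//= ler_piMr ?ltW.
- by rewrite mulr_ge0 ?(ltW pi0) ?(ltW p0)//= ler_piMr ?ltW.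
by rewrite ltr_pM2l//; split => [[]|]//; split => //; lra.
Qed.

Let S_sigma : sigma_algebra setT S := approximable_sigma_algebra rho0 real_trig_algebra.

Let approximable_preimage (pr : plane R -> measurableTypeR R) :
  (forall c, S [set p | c < pr p]) ->
  forall B, measurable B -> S (pr @^-1` B).
Proof.
move=> Sray B.
have : @measurable _ (measurableTypeR R) `<=` image_set_system setT pr S.
  have -> : @measurable _ (measurableTypeR R) = <<s @RGenOInfty.G R>>.
    exact: RGenOInfty.measurableE.
  apply: smallest_sub; first exact: sigma_algebra_image.
  move=> _ [x ->]; rewrite /image_set_system /= setTI.
  rewrite (_ : _ @^-1` _ = [set p | x < pr p]); first exact: Sray.
  by apply/funext => p /=; rewrite in_itv/= andbT.
by move=> h /h; rewrite /image_set_system /= setTI.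
Qed.

(** The rays in each coordinate generate the Borel sets of the plane. *)
Lemma approximable_measurable (B : set (plane R)) : measurable B -> S B.
Proof.
have sin_pos (x : R) : 0 < x < 1 -> 0 < sin (pi * x).
  move=> /andP[x0 x1]; have pi0 := pi_gt0 R.
  by apply: sin_gt0_pi; rewrite mulr_gt0//= gtr_pMr.
have legs1 (p : plane R) : open_legs p ->
    (0 < p.1 < 1 /\ 0 < sin (pi * (p.1 - p.2)) /\
      cos (pi * (p.1 - p.2)) = cos (pi * p.1)) \/
    (p.1 = 0 /\ sin (pi * (p.1 - p.2)) < 0).
  case=> [[x01 y0]|[x0 y01]].
    by left; rewrite y0 subr0; split => //; split => //; exact: sin_pos.
  by right; rewrite x0 sub0r mulrN sinN oppr_lt0; split => //; exact: sin_pos.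
have legs2 (p : plane R) : open_legs p ->
    (0 < p.2 < 1 /\ 0 < (cst (-1) \* (fun p => sin (pi * (p.1 - p.2)))) p /\
      cos (pi * (p.1 - p.2)) = cos (pi * p.2)) \/
    (p.2 = 0 /\ (cst (-1) \* (fun p => sin (pi * (p.1 - p.2)))) p < 0).
  case=> [[x01 y0]|[x0 y01]] /=.
    by right; rewrite y0 subr0 mulN1r oppr_lt0; split => //; exact: sin_pos.
  left; rewrite x0 sub0r !mulrN sinN cosN mulN1r opprK.
  by split => //; split => //; exact: sin_pos.
apply: smallest_sub => // C [[D mD <-]|[D mD <-]]; rewrite setTI.
- apply: approximable_preimage => // c; apply: approximable_ray legs1 => //.
  exact: real_trig_sin.
- apply: approximable_preimage => // c; apply: approximable_ray legs2 => //.
  apply: (bounded_algebraM real_trig_algebra); last exact: real_trig_sin.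
  exact: (bounded_algebra_cst real_trig_algebra).
Qed.

Definition antidiagonal_half_integers : set (R * R) := range half_freq.

(** The real and imaginary parts are approximated separately by real-valued
   trigonometric polynomials. *)
Lemma dense_antidiagonal : dense_span rho0 (exps antidiagonal_half_integers).
Proof.
move=> f [mr [mi /L2norm_lty fin]] e e0.
have part (g : plane R -> R) : measurable_fun setT g ->
    (forall p, g p ^+ 2 <= sqmodulus (f p)) -> approximable rho0 real_trig g.
  move=> mg gf; apply: (approximable_L2 real_trig_algebra) => //.
    exact: approximable_measurable.
  apply/integrableP; split.
    by apply/measurable_EFinP; exact: measurable_funX.
  apply: le_lt_trans fin; apply: ge0_le_integral => //.
  - apply: measurableT_comp => //; apply/measurable_EFinP; exact: measurable_funX.
  - apply/measurable_EFinP; rewrite /sqmodulus.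
    by apply: measurable_funD; exact: measurable_funX.
  - by move=> p _; rewrite lee_fin ger0_norm ?sqr_ge0.
have e2 : 0 < e ^+ 2 / 2 by rewrite divr_gt0// exprn_gt0.
have [_ /(_ _ e2)[q1 tq1 h1]] : approximable rho0 real_trig (fun p => complex.Re (f p)).
  by apply: part => // p; rewrite lerDl sqr_ge0.
have [_ /(_ _ e2)[q2 tq2 h2]] : approximable rho0 real_trig (fun p => complex.Im (f p)).
  by apply: part => // p; rewrite lerDr sqr_ge0.
have [s hs] := trigD tq1 (trigM (trig_cst (Complex 0 1)) tq2).
exists (size s), (fun i => (nth (0, 0) s i).1),
  (fun i => expo (half_freq (nth (0, 0) s i).2)); split.
  by move=> i; apply: imageP; exists (nth (0, 0) s i).2.
have E p : f p - \sum_(i < size s) (nth (0, 0) s i).1 * expo (half_freq (nth (0, 0) s i).2) p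
    = Complex (complex.Re (f p) - q1 p) (complex.Im (f p) - q2 p).
  have -> : \sum_(i < size s) (nth (0, 0) s i).1 * expo (half_freq (nth (0, 0) s i).2) p =
      Complex (q1 p) (q2 p).
    transitivity (trig_sum s p); first by rewrite /trig_sum (big_nth (0, 0)) big_mkord.
    by rewrite -hs; apply/eqP; rewrite eq_complex /=; apply/andP; split; apply/eqP; ring.
  by case: (f p).
apply/L2norm_lt => //; under eq_integral do rewrite E.
have msq (g h : plane R -> R) : measurable_fun setT g -> measurable_fun setT h ->
    measurable_fun setT (fun p => ((g p - h p) ^+ 2)%:E).
  by move=> mg mh; apply/measurable_EFinP/measurable_funX; exact: measurable_funB.
have mq q : real_trig q -> measurable_fun setT q.
  by move=> /(bounded_algebra_bm real_trig_algebra)[].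
rewrite /sqmodulus /=; under eq_integral do rewrite EFinD.
rewrite ge0_integralD//=; last 4 first.
- by move=> p _; rewrite lee_fin sqr_ge0.
- by apply: msq => //; exact: mq.
- by move=> p _; rewrite lee_fin sqr_ge0.
- by apply: msq => //; exact: mq.
have -> : e ^+ 2 = e ^+ 2 / 2 + e ^+ 2 / 2 by field.
by rewrite EFinD; exact: lteD.
Qed.

Lemma spectrum0 : spectrum rho0 antidiagonal_half_integers.
Proof.
split; first by apply: (sub_countable (card_image_le _ _)); exact: countableP.
split; last exact: dense_antidiagonal.
- by move=> _ [l _ <-]; exact/cbm_L2/cbm_expo.
- move=> _ _ [_ [j _ <-] <-] [_ [k _ <-] <-].
  have [->|jk] := eqVneq j k.
    rewrite L2dot_expo /= !subrr !mulr0 !mul0r cos0 sin0 /sinc eqxx asboolT//.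
    by apply/eqP; rewrite eq_complex /=; apply/andP; split; apply/eqP; field.
  rewrite (_ : `[< _ >] = false); last first.
    apply/asboolPn => /expo_inj[+ _]; apply/eqP; rewrite (inj_eq (mulIf _)) ?invr_eq0//.
    by rewrite eqr_int.
  apply: (@antidiagonal_orthogonal _ (j - k)); first by rewrite subr_eq0.
  - by rewrite /= intrD mulrNz mulrBl.
  - by rewrite /= intrD mulrNz mulrBl opprB opprK addrC.
Qed.

End existence.

Theorem theorem1p3 (R : realType) (t : R) (ht : - 2^-1 < t) (ht0 : t <= 0) :
  (t = 0 ->
     spectral (rho t) /\
     forall L L' : set (R * R), spectrum (rho t) L -> spectrum (rho t) L' ->
       exists v : R * R, L' = [set l + v | l in L]) /\
  (forall a : int, 1 < a -> 2 * t + 1 = 1 / a%:~R -> ~ spectral (rho t)).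
Proof.
split=> [->|a a1 ta]; last exact: not_spectral ta.
by split; [exists antidiagonal_half_integers; exact: spectrum0|exact: spectrum0_unique].
Qed.
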